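(* Let $(T_n)_{n\ge 1}$ be a uniform random recursive tree and let $R_n$ be the betweenness rank of the root (vertex $1$) in $T_n$. Then $R_n$ is persistent: there exist integer-valued random variables $N,K$ with $\mathbb{P}(N<\infty)=\mathbb{P}(K<\infty)=1$ such that $R_n=K$ for all $n\ge N$.
   Context: A uniform random recursive tree (URRT) is a random sequence of trees $(T_n)_{n\ge 1}$ with $V(T_n)=[n]=\{1,\ldots,n\}$: $T_1$ is the single vertex $1$ (the root), and $T_{n+1}$ is obtained from $T_n$ by adding vertex $n+1$ and an edge $\{i,n+1\}$, where $i$ is chosen uniformly at random from $[n]$, independently of the past. The betweenness centrality of $v\in V(T_n)$ is $\mathcal{B}_{T_n}(v)=\sum_{s,t\in V(T_n):\,s,t\ne v}\mathbf{1}_{\{v\in\sigma_{s,t}\}}$, where $\sigma_{s,t}$ is the path between $s$ and $t$ in $T_n$ excluding $s$ and $t$; larger values correspond to more central vertices. Ranking: vertices are ordered from most to least central; vertices with equal centrality value are ordered in reverse order of insertion time (if $u,v$ have equal centrality, $u$ is ranked before $v$ iff $u>v$). This gives a permutation $\gamma_n$ of $[n]$, where $\gamma_n(v)\in\{1,\ldots,n\}$ is the position of $v$ in this order (position $1$ being most central). The rank of the root is $R_n=\gamma_n(1)$. *)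

(* Defs.v *)
From HB Require Import structures.
From mathcomp Require Import all_boot all_order all_algebra.
From mathcomp Require Import all_classical all_reals all_analysis measurable_realfun.

Set Implicit Arguments.
Unset Strict Implicit.
Unset Printing Implicit Defensive.

Import Order.TTheory GRing.Theory Num.Theory.

Local Open Scope classical_set_scope.
Local Open Scope ring_scope.

(* A graph on the vertex set [n] = {1, ..., n} is given by its adjacency
   relation on nat, together with n. *)
Definition vertices (n : nat) : seq nat := iota 1 n.

Definition simple_path (e : rel nat) (s t : nat) (p : seq nat) : Prop :=
  [/\ path e s p, last s p = t & uniq (s :: p)].

(* v lies on sigma_{s,t}, the path from s to t without its two endpoints:
   [belast s p] is the vertex list [s :: p] without its last item, and [behead]
   then removes s.  In a tree the simple path p is unique. *)
Definition on_sigma (e : rel nat) (s t v : nat) : bool :=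
  `[< exists2 p, simple_path e s t p & v \in behead (belast s p) >].

(* The sum ranges over ordered pairs (s, t); the pairs with s = t contribute 0. *)
Definition betweenness (e : rel nat) (n v : nat) : nat :=
  (\sum_(s <- vertices n | s != v) \sum_(t <- vertices n | t != v)
     on_sigma e s t v)%N.

(* Total order: decreasing betweenness, ties broken in favour of larger labels. *)
Definition ranked_before (e : rel nat) (n : nat) : rel nat := fun u v =>
  (betweenness e n v < betweenness e n u)%N
  || ((betweenness e n u == betweenness e n v) && (v <= u)%N).

Definition ranking (e : rel nat) (n : nat) : seq nat :=
  sort (ranked_before e n) (vertices n).

(* gamma_n(v); [index] counts positions from 0. *)
Definition rank (e : rel nat) (n v : nat) : nat := (index v (ranking e n)).+1.

Definition add_edge (e : rel nat) (a b : nat) : rel nat := fun x y =>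
  [|| e x y, (x == a) && (y == b) | (x == b) && (y == a)].

Section random_trees.
Context d (Omega : measurableType d) (R : realType) (P : probability Omega R).

(* The sigma-algebra generated by U 1, ..., U n.-1. *)
Definition past (U : nat -> {RV P >-> nat}) (n : nat) : set (set Omega) :=
  <<s [set E | exists k (B : set nat), (0 < k < n)%N /\ E = U k @^-1` B] >>.

(* T n w is the adjacency relation of the tree T_n, for n >= 1, and U n w is the
   vertex of T_n to which the vertex n.+1 is attached; the values at n = 0 are
   irrelevant. *)
Definition is_URRT (T : nat -> Omega -> rel nat) : Prop :=
  exists U : nat -> {RV P >-> nat},
  [/\ forall n w, (0 < n)%N -> U n w \in vertices n,
      forall n i, (0 < n)%N -> i \in vertices n ->
        P (U n @^-1` [set i]) = (n%:R^-1)%:E,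
      forall n (A : set nat) E, (0 < n)%N -> past U n E ->
        P (U n @^-1` A `&` E) = (P (U n @^-1` A) * P E)%E,
      forall w x y, T 1%N w x y = false &
      forall n w x y, (0 < n)%N ->
        T n.+1 w x y = add_edge (T n w) (U n w) n.+1 x y].

Definition extended_integer_valued (X : Omega -> \bar R) : Prop :=
  forall w, (exists k : int, X w = (k%:~R)%:E) \/ X w = +oo%E.

End random_trees.

(* Main.v *)
(* Write Q(v) for the number of ordered pairs (s, t) in the same component of
   T_n - v, so that the betweenness of v is (n-1)^2 - Q(v) and the rank of the
   root only depends on the signs of D(v) = Q(1) - Q(v), v > 1.
   - One attachment multiplies the mean of D(v) by 1 + 2/n and changes D(v) by
     at most 2n. Hence M = D(v)/(n(n+1)) is a martingale with increments O(1/n),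
     and after time m it moves by more than delta with probability
     O(1/(m delta^2)).
   - Given three children of the root, two of them, u and w, do not lead to v.
     Conditionally on everything except the way in which their two branches
     share new vertices, the size x of the first branch has density O(1/r),
     where r is the total size of both branches, and
     D(v) = F + x^2 + (r-x)^2; so D(v) is unlikely to be small compared to n^2.
   - Hence almost surely |D(v)| > delta n(n+1) eventually, and the sign of D(v)
     is eventually constant. With v = 0, for which Q(0) = n^2, the same
     argument bounds n^2 - Q(1) from below.
   - The size S of the subtree of v makes S(S+1)/(n(n+1)) a martingale started
     from 2/(v(v+1)), which is summable, and n^2 - Q(v) <= 2 n S. By
     Borel-Cantelli, only finitely many v ever compete with the root. *)

Require Import Defs.
From HB Require Import structures.
From mathcomp Require Import all_boot all_order all_algebra.
From mathcomp Require Import all_classical all_reals all_analysis measurable_realfun.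
From mathcomp Require Import zify ring lra.

Set Implicit Arguments.
Unset Strict Implicit.
Unset Printing Implicit Defensive.

Import Order.TTheory GRing.Theory Num.Theory.

Local Open Scope classical_set_scope.
Local Open Scope ring_scope.

(** * Trees as attachment histories, components and paths *)

Lemma mem_vertices n s : (s \in vertices n) = (0 < s <= n)%N.
Proof. by rewrite mem_iota; lia. Qed.

Lemma verticesS n : vertices n.+1 = rcons (vertices n) n.+1.
Proof. by rewrite /vertices -[n.+1]addn1 iotaD cats1 add1n addn1. Qed.

Lemma uniq_vertices n : uniq (vertices n).
Proof. exact: iota_uniq. Qed.

(* A history l lists attachment points, the most recent one first; it encodes
   a recursive tree on vertices (size l).+1. *)
Fixpoint valid (l : seq nat) : bool :=
  if l is i :: l' then (i \in vertices (size l').+1) && valid l' else true.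

Fixpoint edge (l : seq nat) : rel nat :=
  if l is i :: l' then add_edge (edge l') i (size l').+2 else fun _ _ => false.

(* Names the component of s in the tree without v: by the child of v leading to
   s, or by 0 if the component contains the vertices older than v. Moreover v is
   labelled by v, and everything by 0 when v = 0. *)
Fixpoint lab (v : nat) (l : seq nat) (s : nat) : nat :=
  if l is i :: l' then
    if s == (size l').+2 then
      if (s == v) || (i == v) then s else lab v l' i
    else lab v l' s
  else (v == 1)%N.

Lemma lab_cons_old v i l s : s != (size l).+2 -> lab v (i :: l) s = lab v l s.
Proof. by move=> /= /negPf ->. Qed.

Lemma lab_cons_new v i l : lab v (i :: l) (size l).+2 =
  if ((size l).+2 == v) || (i == v) then (size l).+2 else lab v l i.
Proof. by rewrite /= eqxx. Qed.

Lemma lab_consE v i l s : s \in vertices (size l).+1 ->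
  lab v (i :: l) s = lab v l s.
Proof. by rewrite mem_vertices => hs; apply: lab_cons_old; lia. Qed.

Lemma lab_le v l s : (lab v l s <= (size l).+1)%N.
Proof.
elim: l s => [|i l IH] s /=; first by case: (v == 1)%N.
have := IH s; have := IH i; case: eqP => [->|_]; last lia.
by case: ifP => _; lia.
Qed.


Lemma lab_unborn v l s : valid l -> ((size l).+1 < v)%N -> lab v l s = 0%N.
Proof.
elim: l s => [|i l IH] s /=; first by case: eqP => // ->.
rewrite mem_vertices => /andP[hi hl] hv; case: eqP => [->|_]; last by apply: IH => //; lia.
rewrite ifF; first by apply: IH => //; lia.
by apply/negP; move=> /orP[/eqP h|/eqP h]; lia.
Qed.

Lemma lab_root v l : v != 1%N -> lab v l 1 = 0%N.
Proof. by move=> /negPf hv; elim: l => [|i l IH] /=; rewrite ?hv. Qed.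

Lemma lab_self v l : v \in vertices (size l).+1 -> lab v l v = v.
Proof.
elim: l => [|i l IH]; first by rewrite mem_vertices /=; case: v => [|[|]].
rewrite mem_vertices => hv /=; case: eqP => [->|ne]; first by rewrite eqxx.
by apply: IH; rewrite mem_vertices; move: hv => /=; lia.
Qed.

Lemma lab_neq v l s : valid l -> (0 < v)%N -> s \in vertices (size l).+1 ->
  s != v -> lab v l s != v.
Proof.
move=> hl hv; elim: l s hl => [|i l IH] s hl.
  by rewrite mem_vertices /= => hs ne; case: (v =P 1%N) => /=; lia.
rewrite mem_vertices /= => hs ne; move: hl => /= /andP[hi hl].
case: (s =P (size l).+2) => [sE|sE]; last by apply: IH => //; rewrite mem_vertices; lia.
case: ifP => // /negbT; rewrite negb_or => /andP[_ iv].
exact: IH.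
Qed.

Lemma edge_vertices l x y : valid l -> edge l x y ->
  [/\ x \in vertices (size l).+1, y \in vertices (size l).+1 & x != y].
Proof.
elim: l x y => [//|i l IH] x y /= /andP[hi hl].
rewrite /add_edge !mem_vertices; move: hi; rewrite mem_vertices => hi.
case/or3P => [/(IH _ _ hl)|/andP[/eqP-> /eqP->]|/andP[/eqP-> /eqP->]].
- by rewrite !mem_vertices => -[h1 h2 h3]; split => //; lia.
- by split; lia.
- by split; lia.
Qed.

Lemma edge_sym l x y : edge l x y = edge l y x.
Proof.
elim: l x y => [//|i l IH] x y /=; rewrite /add_edge IH; congr (_ || _).
by rewrite orbC (andbC (y == _)) (andbC (y == _)).
Qed.

(** A new edge with neither end at [v] gives the new vertex the label of its attachment point, so
    labels change only across [v]. *)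
Lemma edge_lab v l x y : valid l -> edge l x y -> x != v -> y != v ->
  lab v l x = lab v l y.
Proof.
elim: l x y => [//|i l IH] x y /= /andP[]; rewrite mem_vertices => hi hl.
have hne : i != (size l).+2 by lia.
rewrite /add_edge; case/or3P => [h|/andP[/eqP-> /eqP->]|/andP[/eqP-> /eqP->]].
- move=> xv yv; case: (edge_vertices hl h); rewrite !mem_vertices => hx hy _.
  have -> : (x == (size l).+2) = false by lia.
  have -> : (y == (size l).+2) = false by lia.
  exact: IH.
- by move=> xv yv; rewrite eqxx (negPf hne) (negPf xv) (negPf yv).
- by move=> xv yv; rewrite eqxx (negPf hne) (negPf xv) (negPf yv).
Qed.

Lemma edge_nbr_lab v l a : valid l -> (0 < v)%N -> edge l a v ->
  lab v l a = (if (a < v)%N then 0%N else a).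
Proof.
move=> hl hv; elim: l hl a => [//|i l IH] /= /andP[]; rewrite mem_vertices => hi hl a.
rewrite /add_edge; case/or3P => [h|/andP[/eqP-> /eqP vE]|/andP[/eqP aE /eqP vE]].
- case: (edge_vertices hl h); rewrite !mem_vertices => ha _ _.
  have -> : (a == (size l).+2) = false by lia.
  exact: IH.
- have -> : (i == (size l).+2) = false by lia.
  have -> : (i < v)%N by lia.
  by rewrite lab_unborn //; lia.
- rewrite aE eqxx vE eqxx orbT.
  by have -> : ((size l).+2 < i)%N = false by lia.
Qed.

Lemma edge_parent_uniq l a b v : valid l -> edge l a v -> edge l b v ->
  (a < v)%N -> (b < v)%N -> a = b.
Proof.
elim: l => [//|i l IH] /= /andP[]; rewrite mem_vertices => hi hl.
rewrite /add_edge; case/or3P => [h|/andP[/eqP-> /eqP vE]|/andP[/eqP aE /eqP vE]];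
  case/or3P => [h'|/andP[/eqP-> /eqP vE']|/andP[/eqP bE' /eqP vE']] //; try lia.
- by have [_ h1 _] := edge_vertices hl h; move: h1; rewrite mem_vertices; lia.
- by have [_ h1 _] := edge_vertices hl h'; move: h1; rewrite mem_vertices; lia.
Qed.

(** Acyclicity in the form needed: among the neighbours of [v], only the parent has label 0, and
    each child names its own component. *)
Lemma edge_nbr_inj v l a b : valid l -> edge l a v -> edge l b v ->
  lab v l a = lab v l b -> a = b.
Proof.
move=> hl ha hb.
have [] := edge_vertices hl ha; rewrite !mem_vertices => a0 v0 av.
have [] := edge_vertices hl hb; rewrite !mem_vertices => b0 _ bv.
have hv : (0 < v)%N by lia.
rewrite (edge_nbr_lab hl hv ha) (edge_nbr_lab hl hv hb).
case: ifP => h1; case: ifP => h2; try lia.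
by move=> _; apply: (edge_parent_uniq hl ha hb).
Qed.

Lemma edge_connected l s t : valid l ->
  s \in vertices (size l).+1 -> t \in vertices (size l).+1 ->
  exists2 p, path (edge l) s p & last s p = t.
Proof.
elim: l s t => [|i l IH] s t.
  by rewrite !mem_vertices /= => _ hs ht; exists [::] => //=; lia.
move=> /= /andP[hi hl]; rewrite !mem_vertices => hs ht.
rewrite -[add_edge _ _ _]/(edge (i :: l)).
have sub : subrel (edge l) (edge (i :: l)).
  by move=> x y h; rewrite /= /add_edge h.
have hik : edge (i :: l) i (size l).+2 by rewrite /= /add_edge !eqxx orbT.
have hki : edge (i :: l) (size l).+2 i by rewrite edge_sym.
move: (edge (i :: l)) sub hik hki => e sub hik hki.
have old x y : x \in vertices (size l).+1 -> y \in vertices (size l).+1 ->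
    exists2 p, path e x p & last x p = y.
  move=> hx hy; have [p hp lp] := IH x y hl hx hy.
  by exists p => //; apply: sub_path hp.
case: (s =P (size l).+2) => [->|sk]; case: (t =P (size l).+2) => [->|tk].
- by exists [::].
- have [|p hp lp] := old i t hi; first by rewrite mem_vertices; lia.
  by exists (i :: p); [rewrite /= hki | rewrite /=].
- have [|p hp lp] := old s i _ hi; first by rewrite mem_vertices; lia.
  by exists (rcons p (size l).+2); rewrite ?last_rcons // rcons_path hp lp hik.
- by apply: old; rewrite mem_vertices; lia.
Qed.

Lemma path_lab v l s p : valid l -> path (edge l) s p -> v \notin s :: p ->
  lab v l s = lab v l (last s p).
Proof.
move=> hl; elim: p s => [//|x p IH] s; rewrite /=.
move=> /andP[e hp]; rewrite !inE !negb_or => /and3P[vs vx vp].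
rewrite (@edge_lab v l s x) //; last 2 first.
- by rewrite eq_sym.
- by rewrite eq_sym.
by apply: IH => //; rewrite inE negb_or vx.
Qed.

(** A path avoiding [v] keeps its label. A simple path through [v] enters and leaves it by distinct
    neighbours, which lie in different components. *)
Lemma on_sigmaE l s t v : valid l ->
  s \in vertices (size l).+1 -> t \in vertices (size l).+1 ->
  s != v -> t != v ->
  on_sigma (edge l) s t v = (lab v l s != lab v l t).
Proof.
move=> hl hs ht sv tv; apply/asboolP/idP.
  case=> p [hp lp up] hv.
  have vp : v \in p.
    by case: p hv {hp lp up} => //= x p; rewrite inE => /mem_belast.
  case/splitPr: vp hp lp up hv => p1 p2.
  rewrite cat_path last_cat /= => /and3P[hp1 e1 hp2] lp.
  rewrite mem_cat !inE !negb_or cat_uniq /= !negb_or => up _.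
  case: p2 lp hp2 up => [/= vt|b p2]; first by rewrite vt eqxx in tv.
  rewrite /= => lp /andP[e2 hp2].
  rewrite !inE !negb_or -!andbA.
  case/and5P => s1 _ sb s2 /and5P[u1 v1 b1 _ /and3P[vb v2 _]].
  have l1 : lab v l s = lab v l (last s p1).
    by apply: path_lab => //; rewrite inE negb_or eq_sym sv v1.
  have l2 : lab v l b = lab v l t.
    by rewrite -lp; apply: path_lab => //; rewrite inE negb_or vb v2.
  rewrite l1 -l2; apply/eqP => heq.
  have e2' : edge l b v by rewrite edge_sym.
  have bE := edge_nbr_inj hl e1 e2' heq.
  have : b \in s :: p1 by rewrite -bE mem_last.
  rewrite inE (negPf b1) orbF => /eqP bs.
  by rewrite bs eqxx in sb.
move=> ne; have [p hp lp] := edge_connected hl hs ht.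
case/shortenP: hp lp => p' hp' up _ lp; exists p' => //.
have : v \in s :: p'.
  apply: contraNT ne => vp; rewrite -lp; apply/eqP; exact: path_lab.
case: p' lp {hp' up} => [/= st|x p']; first by rewrite inE eq_sym (negPf sv).
rewrite inE eq_sym (negPf sv) /= => lp; rewrite lastI mem_rcons lp inE.
by rewrite eq_sym (negPf tv).
Qed.

(** * Component sizes, betweenness and the rank of the root *)

Arguments lab : simpl never.
Arguments edge : simpl never.

Definition cls (v : nat) (l : seq nat) (a : nat) : nat :=
  (\sum_(s <- vertices (size l).+1) (lab v l s == a))%N.

(** The quantity Q(v) of the overview; the diagonal pairs are included. *)
Definition same_comp (v : nat) (l : seq nat) : nat :=
  (\sum_(s <- vertices (size l).+1 | s != v) cls v l (lab v l s))%N.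

(** The number of old vertices in the component that a vertex attached to [i] joins; attached to [v]
    itself, it starts a component of its own. *)
Definition link (v : nat) (l : seq nat) (i : nat) : nat :=
  if i == v then 0%N else cls v l (lab v l i).

Lemma sum_verticesS n (p : pred nat) (F : nat -> nat) :
  (\sum_(s <- vertices n.+1 | p s) F s =
  \sum_(s <- vertices n | p s) F s + (if p n.+1 then F n.+1 else 0))%N.
Proof. by rewrite verticesS -cats1 big_cat /= big_cons big_nil addn0. Qed.

Lemma cls_cons v i l a :
  cls v (i :: l) a = (cls v l a + (lab v (i :: l) (size l).+2 == a))%N.
Proof.
rewrite /cls -[size (i :: l)]/(size l).+1 sum_verticesS; congr (_ + _)%N.
by apply: eq_big_seq => s hs; rewrite lab_consE.
Qed.

Lemma cls_fresh v l a : ((size l).+1 < a)%N -> cls v l a = 0%N.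
Proof.
move=> ha; rewrite /cls big1 // => s _.
by have := lab_le v l s; case: eqP => //; lia.
Qed.

(** Only [v] has label [v], so leaving it out of the sum loses nothing. *)
Lemma cls_neq v l i : valid l -> (v <= (size l).+1)%N ->
  i \in vertices (size l).+1 -> i != v ->
  (\sum_(s <- vertices (size l).+1 | s != v) (lab v l i == lab v l s))%N =
  cls v l (lab v l i).
Proof.
move=> hl hv hi iv; rewrite /cls big_mkcond /=; apply: eq_big_seq => s hs.
case: (s =P v) => sv /=; last by rewrite eq_sym.
have v0 : (0 < v)%N by move: hs; rewrite sv mem_vertices; lia.
have hv' : v \in vertices (size l).+1 by rewrite mem_vertices v0.
have := lab_neq hl v0 hi iv.
by rewrite sv (lab_self hv') eq_sym => /negPf ->.
Qed.

(** Each old vertex in the component of the new one contributes two ordered pairs, and the new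
    vertex forms one pair with itself. *)
Lemma same_comp_cons v i l : valid l -> (v <= (size l).+1)%N ->
  i \in vertices (size l).+1 ->
  same_comp v (i :: l) = (same_comp v l + 2 * link v l i + 1)%N.
Proof.
move=> hl hv hi; rewrite /same_comp -[size (i :: l)]/(size l).+1 sum_verticesS.
have kv : (size l).+2 != v by lia.
rewrite kv.
have -> : \sum_(s <- vertices (size l).+1 | s != v) cls v (i :: l) (lab v (i :: l) s) =
  (\sum_(s <- vertices (size l).+1 | s != v) cls v l (lab v l s) +
  \sum_(s <- vertices (size l).+1 | s != v)
    (lab v (i :: l) (size l).+2 == lab v l s))%N.
  rewrite -big_split /= big_seq_cond [RHS]big_seq_cond; apply: eq_bigr => s.
  by move=> /andP[hs _]; rewrite cls_cons (lab_consE _ _ hs).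
rewrite cls_cons eqxx lab_cons_new (negPf kv) /= /link.
case: (i =P v) => [iv|/eqP iv]; last by rewrite cls_neq //; lia.
rewrite cls_fresh // [X in (_ + X + _)%N]big1 => [|s _]; first lia.
by have := lab_le v l s; case: eqP => //; lia.
Qed.

(** A uniform attachment to a tree of size n thus adds 2Q(v)/n + 1 to Q(v) on average; the constant
    1 cancels in differences. *)
Lemma sum_link v l :
  (\sum_(i <- vertices (size l).+1) link v l i)%N = same_comp v l.
Proof.
rewrite /same_comp [RHS]big_mkcond /=; apply: eq_bigr => i _.
by rewrite /link; case: eqP.
Qed.

Lemma cls_le v l a : (cls v l a <= (size l).+1)%N.
Proof.
rewrite /cls -{2}(size_iota 1 (size l).+1) -(sum1_size (iota _ _)).
by apply: leq_sum => s _; case: eqP.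
Qed.

Lemma link_le v l i : (link v l i <= (size l).+1)%N.
Proof. by rewrite /link; case: eqP => // _; exact: cls_le. Qed.

Lemma same_comp_le v l : (same_comp v l <= (size l).+1 * (size l).+1)%N.
Proof.
rewrite -sum_link -{2}(size_iota 1 (size l).+1) -(sum1_size (iota _ _)) big_distrl /=.
by apply: leq_sum => s _; rewrite mul1n; exact: link_le.
Qed.

(** Removing the fictitious vertex 0 leaves the whole tree as one component. *)
Lemma same_comp0 l : valid l -> same_comp 0 l = ((size l).+1 * (size l).+1)%N.
Proof.
have lab0 : forall l s, valid l -> s \in vertices (size l).+1 -> lab 0 l s = 0%N.
  move=> {l}; elim=> [|i l IH] s //= /andP[hi hl] hs.
  case: (s =P (size l).+2) => [->|/eqP sE].
    rewrite lab_cons_new; move: (hi); rewrite mem_vertices => hi'.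
    by rewrite ifF ?IH //; lia.
  rewrite lab_cons_old //; apply: IH => //; move: hs; rewrite !mem_vertices /=; lia.
move=> hl; rewrite /same_comp big_seq_cond.
rewrite (eq_bigr (fun=> (size l).+1)) => [|s /andP[hs _]]; last first.
  rewrite lab0 // /cls (eq_big_seq (fun=> 1%N)) => [|t ht]; last by rewrite lab0.
  by rewrite sum1_size size_iota.
rewrite -big_seq_cond big_mkcond (eq_big_seq (fun=> (size l).+1)) => [|s]; last first.
  by rewrite mem_vertices; case: s.
by rewrite big_const_seq count_predT size_iota iter_addn_0.
Qed.

(** Each of the (n-1)^2 ordered pairs avoiding [v] is either separated by [v] or contained in one
    component. *)
Lemma betweenness_same_comp l v : valid l -> v \in vertices (size l).+1 ->
  (betweenness (edge l) (size l).+1 v + same_comp v l = size l * size l)%N.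
Proof.
move=> hl hv; move: (hv); rewrite mem_vertices => hv'.
pose p : pred nat := fun s => s != v.
have cnt : (\sum_(s <- vertices (size l).+1 | s != v) 1 = size l)%N.
  rewrite sum1_count; have := count_predC (pred1 v) (vertices (size l).+1).
  by rewrite count_uniq_mem ?uniq_vertices // hv size_iota => -[].
rewrite /betweenness /same_comp -big_split /=.
rewrite big_seq_cond (eq_bigr (fun=> (1 * size l)%N)); last first.
  move=> s /andP[hs sv]; rewrite -(cls_neq hl _ hs sv); last by lia.
  rewrite -big_split /= mul1n -[RHS]cnt big_seq_cond [RHS]big_seq_cond.
  by apply: eq_bigr => t /andP[ht tv]; rewrite on_sigmaE //; case: eqP.
by rewrite -big_seq_cond -big_distrl /= cnt.
Qed.

Lemma index_sorted (T : eqType) (r : rel T) (x : T) (s : seq T) :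
  transitive r -> antisymmetric r -> sorted r s -> uniq s -> x \in s ->
  index x s = count (fun u => (u != x) && r u x) s.
Proof.
move=> tr asym so us xs; case/splitPr: xs so us => s1 s2 so us.
have [n1 n2] : x \notin s1 /\ x \notin s2.
  move: us; rewrite cat_uniq /= negb_or => /and4P[_ /andP[h1 _] h2 _].
  by [].
rewrite index_cat (negPf n1) /= eqxx addn0 count_cat /= eqxx /= add0n.
have c1 : count (fun u => (u != x) && r u x) s1 = size s1.
  apply/eqP; rewrite -all_count; apply/allP => y ys1; apply/andP; split.
    by apply: contraNneq n1 => <-.
  have := so; rewrite (sorted_pairwise tr) pairwise_cat => /andP[/allrelP h _].
  by apply: h => //; rewrite inE eqxx.
have c2 : count (fun u => (u != x) && r u x) s2 = 0%N.
  apply/eqP; rewrite -leqn0 leqNgt -has_count; apply/hasPn => y ys2.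
  apply/negP => /andP[yx ryx].
  have := so; rewrite (sorted_pairwise tr) pairwise_cat => /and3P[_ _ /=].
  move=> /andP[/allP h _]; have := h y ys2 => rxy.
  by move: yx; rewrite (asym y x) ?eqxx // ryx rxy.
by rewrite c1 c2 addn0.
Qed.

(** Every other vertex is younger than the root and wins ties against it, hence the non-strict
    comparison. *)
Lemma rank_root l : valid l -> rank (edge l) (size l).+1 1 =
  (count (fun u => (u != 1%N) && (same_comp u l <= same_comp 1 l)%N) (vertices (size l).+1)).+1.
Proof.
move=> hl; rewrite /rank /ranking; congr _.+1.
set r := ranked_before _ _.
have tot : total r.
  move=> x y; rewrite /r /ranked_before.
  move: (betweenness _ _ x) (betweenness _ _ y) => a b; lia.
have tr : transitive r.
  move=> y x z; rewrite /r /ranked_before.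
  move: (betweenness _ _ x) (betweenness _ _ y) (betweenness _ _ z) => a b c; lia.
have asym : antisymmetric r.
  move=> x y; rewrite /r /ranked_before.
  move: (betweenness _ _ x) (betweenness _ _ y) => a b; lia.
have h1 : 1%N \in vertices (size l).+1 by rewrite mem_vertices.
rewrite (@index_sorted _ r); first last.
- by rewrite mem_sort.
- by rewrite sort_uniq uniq_vertices.
- exact: sort_sorted.
- exact: asym.
- exact: tr.
have /permP -> : perm_eq (sort r (vertices (size l).+1)) (vertices (size l).+1).
  by rewrite perm_sort.
apply: eq_in_count => u hu; case: eqP => //= u1.
have := betweenness_same_comp hl hu; have := betweenness_same_comp hl h1.
move: hu; rewrite mem_vertices /r /ranked_before.
move: (betweenness _ _ u) (betweenness _ _ _) (same_comp u l) (same_comp _ l) => a b c d.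
by move: (size l * size l)%N => q; lia.
Qed.

(** * Averages over one attachment and supermartingales *)

Definition step (R : realType) (f : seq nat -> R) (l : seq nat) : R :=
  (size l).+1%:R^-1 * \sum_(i <- vertices (size l).+1) f (i :: l).

(* The expectation of f after k uniform attachments to a given history. *)
Definition mean (R : realType) (k : nat) (f : seq nat -> R) : seq nat -> R :=
  iter k (@step R) f.

(** An invariant closed under legal attachments; estimates on means then need checking only on the
    histories that satisfy it. *)
Definition growing (I : seq nat -> Prop) : Prop :=
  forall i l, I l -> i \in vertices (size l).+1 -> I (i :: l).

Lemma ler_step (R : realType) (f g : seq nat -> R) l :
  (forall i, i \in vertices (size l).+1 -> f (i :: l) <= g (i :: l)) ->
  step f l <= step g l.
Proof.
move=> fg; rewrite /step ler_wpM2l ?invr_ge0 ?ler0n // big_seq [leRHS]big_seq.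
exact: ler_sum.
Qed.

Lemma eq_step (R : realType) (f g : seq nat -> R) l :
  (forall i, i \in vertices (size l).+1 -> f (i :: l) = g (i :: l)) ->
  step f l = step g l.
Proof.
by move=> fg; apply/eqP; rewrite eq_le !ler_step // => i hi; rewrite fg.
Qed.

Lemma step_affine (R : realType) (a b : R) (f : seq nat -> R) l :
  step (fun l' => a + b * f l') l = a + b * step f l.
Proof.
rewrite /step big_split /= big_const_seq count_predT size_iota iter_addr_0.
rewrite -mulr_sumr mulrDr -(mulr_natl a) mulKf ?pnatr_eq0 //.
by rewrite mulrCA.
Qed.

Lemma mean_affine (R : realType) (a b : R) k (f : seq nat -> R) l :
  mean k (fun l' => a + b * f l') l = a + b * mean k f l.
Proof.
elim: k l => [//|k IH] l; rewrite /mean !iterS -step_affine.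
by apply: eq_step => i _; exact: IH.
Qed.

Lemma ler_mean (R : realType) (I : seq nat -> Prop) k (f g : seq nat -> R) l :
  growing I -> I l ->
  (forall l', size l' = (k + size l)%N -> I l' -> f l' <= g l') ->
  mean k f l <= mean k g l.
Proof.
move=> gI; elim: k l => [|k IH] l Il fg; first exact: fg.
rewrite /mean !iterS; apply: ler_step => i hi; apply: IH; first exact: gI.
by move=> l' hs; apply: fg; rewrite hs /= addnS.
Qed.

Lemma mean_supermartingale (R : realType) (I : seq nat -> Prop) k
    (f : seq nat -> R) l :
  growing I -> (forall l', I l' -> step f l' <= f l') -> I l ->
  mean k f l <= f l.
Proof.
move=> gI sf; elim: k l => [|k IH] l Il; first exact: lexx.
rewrite /mean iterS; apply: le_trans (sf _ Il); apply: ler_step => i hi.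
by apply: IH; exact: gI.
Qed.

Lemma mean_add (R : realType) m k (f : seq nat -> R) l :
  mean (m + k) f l = mean m (mean k f) l.
Proof. by rewrite /mean iterD. Qed.

(** The tails of a history are its earlier states, so this records whether [A] held at some time
    from [m] on. *)
Fixpoint visits (A : pred (seq nat)) (m : nat) (l : seq nat) : bool :=
  (m <= size l)%N && A l || (if l is _ :: l' then visits A m l' else false).

Lemma visits_small A m l : (size l < m)%N -> visits A m l = false.
Proof. by elim: l => [|i l IH] /= h; rewrite leqNgt h //= IH //; lia. Qed.

(* Stop the supermartingale at the first visit to A. *)
Lemma maximal_inequality (R : realType) (I : seq nat -> Prop)
    (A : pred (seq nat)) k (f : seq nat -> R) l :
  growing I -> (forall l', I l' -> step f l' <= f l') ->
  (forall l', I l' -> 0 <= f l') -> (forall l', I l' -> A l' -> 1 <= f l') ->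
  I l -> mean k (fun l' => (visits A (size l) l')%:R) l <= f l.
Proof.
move=> gI sf f0 fA Il; set m := size l.
pose J l' := I l' /\ (m <= size l')%N.
have gJ : growing J.
  by move=> i l' [h1 h2] hi; split; [exact: gI | rewrite /=; lia].
pose g l' : R := if visits A m l' then 1 else f l'.
have sg l' : J l' -> step g l' <= g l'.
  move=> [Il' ml']; rewrite {2}/g; case: ifP => [hv|/negbT hv].
    rewrite (@eq_step _ _ (fun l => 1 + 0 * f l)) => [|i _].
      by rewrite step_affine mul0r addr0.
    by rewrite /g /= hv orbT mul0r addr0.
  apply: le_trans (sf _ Il'); apply: ler_step => i hi; rewrite /g /=.
  rewrite (negPf hv) orbF; case: ifP => // /andP[_ hA].
  by apply: fA => //; exact: gI.
have Jl : J l by split.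
apply: (@le_trans _ _ (mean k g l)).
  apply: (ler_mean gJ Jl) => l' _ [Il' _]; rewrite /g.
  by case: (visits _ _ _) => //=; exact: f0.
apply: le_trans (mean_supermartingale k gJ sg Jl) _.
(* At the starting time [m] the visit can only be at [l] itself, as its proper tails are too
   short. *)
rewrite /g; case: ifP => // hv; apply: fA => //; move: hv.
rewrite /m; case: l {Il m J gJ g sg Jl} => [|i l] /=; first by rewrite orbF.
by rewrite leqnn visits_small ?orbF.
Qed.

(** * The martingales of the gap and of the subtree size *)

Lemma growing_valid v : growing (fun l => valid l /\ (v <= (size l).+1)%N).
Proof. by move=> i l [h1 h2] /= hi; rewrite h1 hi; split => //; lia. Qed.

Definition gap (R : realType) (v : nat) (l : seq nat) : R :=
  (same_comp 1 l)%:R - (same_comp v l)%:R.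

(** The martingale M of the overview, with n = [(size l).+1]. *)
Definition ngap (R : realType) (v : nat) (l : seq nat) : R :=
  gap R v l / ((size l).+1%:R * (size l).+2%:R).

Lemma gap_cons (R : realType) v i l : valid l -> (v <= (size l).+1)%N ->
  i \in vertices (size l).+1 ->
  gap R v (i :: l) = gap R v l + 2 * ((link 1 l i)%:R - (link v l i)%:R).
Proof.
move=> hl hv hi; rewrite /gap !same_comp_cons // !natrD; ring.
Qed.

Lemma sum_link_gap (R : realType) v l :
  \sum_(i <- vertices (size l).+1) ((link 1 l i)%:R - (link v l i)%:R) =
  gap R v l.
Proof. by rewrite big_split /= sumrN -!natr_sum !sum_link. Qed.

Lemma link_sub_le (R : realType) v l i :
  `|(link 1 l i)%:R - (link v l i)%:R| <= (size l).+1%:R :> R.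
Proof.
have : (link 1 l i)%:R <= (size l).+1%:R :> R by rewrite ler_nat link_le.
have : (link v l i)%:R <= (size l).+1%:R :> R by rewrite ler_nat link_le.
have : 0 <= (link v l i)%:R :> R by rewrite ler0n.
have : 0 <= (link 1 l i)%:R :> R by rewrite ler0n.
by rewrite ler_norml; lra.
Qed.

(** As [ngap] is a martingale, its mean square about [c] grows by at most the mean squared
    increment, itself at most 4n^2/((n+1)(n+2))^2. The decrease 4/(n+1) - 4/(n+2) of the added term
    pays for it. *)
Lemma step_ngap_sqr (R : realType) v (c : R) l :
  valid l -> (v <= (size l).+1)%N ->
  step (fun l' => (ngap R v l' - c) ^+ 2 + 4 / (size l').+2%:R) l <=
  (ngap R v l - c) ^+ 2 + 4 / (size l).+2%:R.
Proof.
move=> hl hv; rewrite /step.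
set n : R := (size l).+1%:R; set x := gap R v l.
have n1 : 1 <= n by rewrite /n ler1n.
have nS : (size l).+2%:R = n + 1 by rewrite /n -natr1.
have nSS : (size l).+3%:R = n + 2 by rewrite /n -!natr1; ring.
pose q := ((n + 1) * (n + 2))^-1.
have q0 : 0 < q by rewrite invr_gt0 mulr_gt0; lra.
pose d i : R := (link 1 l i)%:R - (link v l i)%:R.
pose a := (q * x - c) ^+ 2 + 4 / (n + 2) + 4 * q ^+ 2 * n ^+ 2.
apply: (@le_trans _ _ (n^-1 *
    \sum_(i <- vertices (size l).+1) (a + 4 * q * (q * x - c) * d i))).
  rewrite ler_wpM2l ?invr_ge0 ?(le_trans ler01) // big_seq [leRHS]big_seq.
  apply: ler_sum => i hi; rewrite /ngap /= gap_cons // nS nSS -/(d i) -/x.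
  have hd : d i ^+ 2 <= n ^+ 2.
    rewrite -[d i ^+ 2](real_normK (num_real _)) ler_sqr ?nnegrE ?normr_ge0 ?(le_trans ler01 n1) //.
    exact: link_sub_le.
  rewrite -/q [X in (X - c) ^+ 2]mulrC.
  have : 0 <= 4 * q ^+ 2 * (n ^+ 2 - d i ^+ 2).
    by rewrite mulr_ge0 ?subr_ge0 // mulr_ge0 // sqr_ge0.
  by rewrite /a; nra.
rewrite big_split /= -mulr_sumr sum_link_gap -/x.
rewrite big_const_seq count_predT size_iota iter_addr_0 -(mulr_natl a) -/n.
rewrite /ngap nS -/n -/x /a /q -subr_ge0.
(* The term in [x ^+ 2] is the squared mean of the increment of the gap; the rest is nonnegative
   since (n+1)(n+2) exceeds n^2. *)
have -> : (x / (n * (n + 1)) - c) ^+ 2 + 4 / (n + 1) -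
   n^-1 * (n * ((((n + 1) * (n + 2))^-1 * x - c) ^+ 2 + 4 / (n + 2) +
       4 * ((n + 1) * (n + 2))^-1 ^+ 2 * n ^+ 2) +
       4 * ((n + 1) * (n + 2))^-1 * (((n + 1) * (n + 2))^-1 * x - c) * x) =
   (4 * x ^+ 2 / n ^+ 2 + 4 * (n + 1) * (n + 2) - 4 * n ^+ 2) /
     ((n + 1) * (n + 2)) ^+ 2.
  by field; lra.
apply: divr_ge0; last exact: sqr_ge0.
have : 0 <= 4 * x ^+ 2 / n ^+ 2 by rewrite divr_ge0 ?sqr_ge0 // mulr_ge0 ?sqr_ge0.
by move: (4 * x ^+ 2 / n ^+ 2) => A hA; lra.
Qed.

(** For [1 < v] this is the size S of the subtree of [v], because exactly the component above [v]
    has label 0. *)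
Definition below (v : nat) (l : seq nat) : nat :=
  (\sum_(s <- vertices (size l).+1) (lab v l s != 0%N))%N.

Lemma below_cons v i l : (1 < v <= (size l).+1)%N ->
  i \in vertices (size l).+1 ->
  below v (i :: l) = (below v l + (lab v l i != 0%N))%N.
Proof.
move=> hv hi; rewrite /below -[size (i :: l)]/(size l).+1 sum_verticesS.
congr (_ + _)%N; first by apply: eq_big_seq => s hs; rewrite lab_consE.
have /negPf kv : (size l).+2 != v by lia.
rewrite /= lab_cons_new kv; case: (i =P v) => [->|//].
rewrite orbT lab_self; first by case: v hv kv.
by rewrite mem_vertices; case/andP: hv => /ltnW ->.
Qed.

Lemma below_birth v l : valid l -> (1 < v)%N -> size l = v.-1 -> below v l = 1%N.
Proof.
case: l => [|i l] /=; first lia.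
move=> /andP[hi hl] hv sz; rewrite /below /= sum_verticesS.
rewrite big_seq big1 ?add0n => [|s]; last first.
  by move=> hs; rewrite lab_consE // lab_unborn //; lia.
by rewrite lab_cons_new ifT //; lia.
Qed.

Definition nbelow (R : realType) (v : nat) (l : seq nat) : R :=
  (below v l)%:R * (below v l).+1%:R / ((size l).+1%:R * (size l).+2%:R).

(** S grows with probability S/n, so the mean of S(S+1) is multiplied by (n+2)/n, as is the
    denominator n(n+1). *)
Lemma step_nbelow (R : realType) v l : (1 < v <= (size l).+1)%N ->
  step (nbelow R v) l = nbelow R v l.
Proof.
move=> hv; rewrite /step /nbelow.
set n : R := (size l).+1%:R; set x : R := (below v l)%:R.
have n1 : 1 <= n by rewrite /n ler1n.
have nS : (size l).+2%:R = n + 1 by rewrite /n -natr1.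
have nSS : (size l).+3%:R = n + 2 by rewrite /n -!natr1; ring.
have xS : (below v l).+1%:R = x + 1 by rewrite /x -natr1.
rewrite (eq_big_seq (fun i => x * (x + 1) / ((n + 1) * (n + 2)) +
   2 * (x + 1) / ((n + 1) * (n + 2)) * (lab v l i != 0%N)%:R)) => [|i hi]; last first.
  rewrite below_cons //= nS nSS -natr1 natrD -/x.
  by case: (lab v l i != 0%N) => /=; field; lra.
rewrite big_split /= big_const_seq count_predT size_iota iter_addr_0.
rewrite -[_ *+ (size l).+1]mulr_natl -mulr_sumr -natr_sum -/(below v l) -/x -/n xS nS.
by field; lra.
Qed.

(** The component above [v] has n - S vertices, so Q(v) is at least (n-S)^2, hence at least n^2 -
    2nS. *)
Lemma same_comp_below v l : valid l -> (1 < v <= (size l).+1)%N ->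
  ((size l).+1 * (size l).+1 <= same_comp v l + 2 * (size l).+1 * below v l)%N.
Proof.
move=> hl hv; set n := (size l).+1.
have hc : (cls v l 0 + below v l = n)%N.
  rewrite /cls /below -big_split /= (eq_bigr (fun=> 1%N)) => [|s _].
    by rewrite sum1_size size_iota.
  by case: eqP.
have : (cls v l 0 * cls v l 0 <= same_comp v l)%N.
  rewrite {1}/cls big_distrl /= /same_comp [X in (_ <= X)%N]big_mkcond /=.
  apply: leq_sum => s _; case: (lab v l s =P 0%N) => [h|//].
  case: (s =P v) => [sv|_] /=; last by rewrite h mul1n.
  by move: h; rewrite sv lab_self ?mem_vertices; lia.
by rewrite -hc; nia.
Qed.

(** * Merging two branches at the root *)

Definition merged (u w : nat) (l : seq nat) (s : nat) : bool :=
  (lab 1 l s == u) || (lab 1 l s == w).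

(* Forgets how the branches of u and w share the vertices attached after time
   n0, by attaching all of them to u itself. *)
Fixpoint redirect (n0 u w : nat) (l : seq nat) : seq nat :=
  if l is i :: l' then
    (if (n0 <= size l')%N && merged u w l' i then u else i) :: redirect n0 u w l'
  else [::].

Lemma size_redirect n0 u w l : size (redirect n0 u w l) = size l.
Proof. by elim: l => [//|i l /= ->]. Qed.

Lemma redirect_id n0 u w l : (size l <= n0)%N -> redirect n0 u w l = l.
Proof.
elim: l => [//|i l IH] /= h; have -> : (n0 <= size l)%N = false by lia.
by rewrite IH //; lia.
Qed.

(** A branch at the root that does not contain [v] stays connected to the root when [v] is
    removed. *)
Lemma lab_off v l s a : valid l -> s \in vertices (size l).+1 ->
  v != 1%N -> a != 1%N -> lab 1 l s = a -> lab 1 l v != a -> lab v l s = 0%N.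
Proof.
move=> + + v1 a1; elim: l s => [|i l IH] s.
  by move=> _ _ _ _; rewrite /lab (negPf v1).
move=> /= /andP[hi hl] hs; case: (s =P (size l).+2) => [->|/eqP sk].
  rewrite !lab_cons_new => sa va.
  have vk : v != (size l).+2.
    by apply: contraNneq va => ->; rewrite lab_cons_new sa.
  move: va; rewrite lab_cons_old // => va.
  have -> : ((size l).+2 == v) = false by rewrite eq_sym; exact: negPf vk.
  move: sa; have /negPf -> : (size l).+2 != 1%N by [].
  case: (i =P 1%N) => [i1|/eqP i1] /= sa.
    by rewrite i1 eq_sym (negPf v1) lab_root.
  case: (i =P v) => [iv|_]; first by move: va; rewrite -iv sa eqxx.
  exact: IH.
rewrite !(lab_cons_old _ _ sk) => sa.
have hs' : s \in vertices (size l).+1.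
  by move: hs; rewrite !mem_vertices; lia.
case: (v =P (size l).+2) => [->|/eqP vk]; last by rewrite lab_cons_old //; exact: IH.
by move=> _; rewrite lab_unborn.
Qed.

(** Redirecting preserves the union of the two branches, the labels at the root outside it, and all
    labels at [v]. These determine the gap up to the way the two branches share their total size. *)
Record merge_inv (n0 u w v : nat) (l : seq nat) : Prop := MergeInv {
  mi_valid : valid l;
  mi_rvalid : valid (redirect n0 u w l);
  mi_size : (n0 <= size l)%N;
  mi_uw : (1 < u < w)%N /\ (w <= (size l).+1)%N;
  mi_labu : lab 1 l u = u;
  mi_labw : lab 1 l w = w;
  mi_rlabu : lab 1 (redirect n0 u w l) u = u;
  mi_v : v != 1%N /\ (v <= (size l).+1)%N;
  mi_mv : merged u w l v = false;
  mi_merged : forall s, s \in vertices (size l).+1 ->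
    merged u w (redirect n0 u w l) s = merged u w l s;
  mi_lab1 : forall s, s \in vertices (size l).+1 -> ~~ merged u w l s ->
    lab 1 (redirect n0 u w l) s = lab 1 l s;
  mi_labv : forall s, s \in vertices (size l).+1 ->
    lab v (redirect n0 u w l) s = lab v l s }.

Lemma merge_inv_init n0 u w v l : size l = n0 -> valid l ->
  (1 < u < w)%N -> (w <= (size l).+1)%N -> lab 1 l u = u -> lab 1 l w = w ->
  v != 1%N -> (v <= (size l).+1)%N -> ~~ merged u w l v ->
  merge_inv n0 u w v l.
Proof.
move=> <- hl uw wn lu lw v1 vn mv.
have rl : redirect (size l) u w l = l by rewrite redirect_id.
by split; rewrite ?rl //; exact/negbTE.
Qed.

Lemma merged1 u w l : (1 < u < w)%N -> merged u w l 1 = false.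
Proof. by move=> uw; rewrite /merged lab_self ?mem_vertices //; lia. Qed.

Lemma merged_cons_new u w l i : (1 < u < w)%N -> (w <= (size l).+1)%N ->
  merged u w (i :: l) (size l).+2 = merged u w l i.
Proof.
move=> uw wn; rewrite /merged lab_cons_new.
have /negPf -> : (size l).+2 != 1%N by [].
case: (i =P 1%N) => [->|//]; rewrite lab_self ?mem_vertices //=; lia.
Qed.

Lemma merged_cons_old u w l i s : s \in vertices (size l).+1 ->
  merged u w (i :: l) s = merged u w l s.
Proof. by move=> hs; rewrite /merged !lab_consE. Qed.

Lemma growing_merge_inv n0 u w v : growing (merge_inv n0 u w v).
Proof.
move=> i l [hl hrl sl [uw wn] lu lw rlu [v1 vn] mv hm h1 hv] hi.
have rE : redirect n0 u w (i :: l) =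
    (if merged u w l i then u else i) :: redirect n0 u w l by rewrite /= sl.
have hu : u \in vertices (size l).+1 by rewrite mem_vertices; lia.
have hw : w \in vertices (size l).+1 by rewrite mem_vertices; lia.
have sr := size_redirect n0 u w l.
have vertS s : s \in vertices (size (i :: l)).+1 ->
    s = (size l).+2 \/ s \in vertices (size l).+1.
  by rewrite !mem_vertices /=; lia.
have mu : merged u w l u by rewrite /merged lu eqxx.
pose j := if merged u w l i then u else i.
have hj : j \in vertices (size l).+1 by rewrite /j; case: ifP.
have mj : merged u w l j = merged u w l i.
  by rewrite /j; case: ifP => // ->.
rewrite -/j in rE.
have labn x : lab x (redirect n0 u w (i :: l)) (size l).+2 =
   if ((size l).+2 == x) || (j == x) then (size l).+2
   else lab x (redirect n0 u w l) j.
  by rewrite rE -sr lab_cons_new.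
have labo x s : s \in vertices (size l).+1 ->
    lab x (redirect n0 u w (i :: l)) s = lab x (redirect n0 u w l) s.
  by move=> hs; rewrite rE lab_consE // sr.
have kv : ((size l).+2 == v) = false by clear -vn; lia.
have u1 : u != 1%N by clear -uw; lia.
have w1 : w != 1%N by clear -uw; lia.
split => //.
- by rewrite /= hi.
- by rewrite rE /= sr hj.
- exact: leqW.
- by split => //; exact: leqW.
- by rewrite lab_consE.
- by rewrite lab_consE.
- by rewrite labo.
- by split => //; exact: leqW.
- by rewrite /merged lab_cons_old -/(merged u w l v) // eq_sym kv.
- move=> s /vertS[->|hs].
    rewrite merged_cons_new // {1}rE -sr merged_cons_new ?sr //.
    by rewrite hm.
  by rewrite [RHS]merged_cons_old // rE merged_cons_old ?sr // hm.
- move=> s /vertS[->|hs].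
    rewrite merged_cons_new // => nm.
    have jE : j = i by rewrite /j (negPf nm).
    by rewrite labn lab_cons_new jE h1.
  by rewrite merged_cons_old // => nm; rewrite labo // lab_consE // h1.
- move=> s /vertS[->|hs]; last by rewrite labo // lab_consE // hv.
  (* In the merged case [i] and [u] both lie in branches avoiding [v], so both have label 0 at
     [v]. *)
  rewrite labn lab_cons_new kv /= /j; case mi: (merged u w l i); last by rewrite hv.
  have iv : (i == v) = false.
    by apply/negbTE; apply: contraTneq mi => ->; rewrite mv.
  have uv : (u == v) = false.
    by case: eqP => // e; move: mu; rewrite {2}e mv.
  rewrite iv uv hv //.
  have off s' : s' \in vertices (size l).+1 -> merged u w l s' -> lab v l s' = 0%N.
    move=> hs' /orP ms'; move: mv; rewrite /merged => /norP[nu nw].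
    by case: ms' => /eqP e; exact: (lab_off hl hs' v1 _ e).
  by rewrite !off.
Qed.

(** * The urn of the two merged branches *)

Definition msize (u w : nat) (l : seq nat) : nat := (cls 1 l u + cls 1 l w)%N.

(** The term F of the overview, unaffected by how the merged branches share their vertices. *)
Definition rest (R : realType) (u w v : nat) (l : seq nat) : R :=
  \sum_(s <- vertices (size l).+1 | (s != 1%N) && ~~ merged u w l s)
     (cls 1 l (lab 1 l s))%:R - (same_comp v l)%:R.

Lemma sum_merged (R : realType) u w l (F : nat -> R) : u != w ->
  \sum_(s <- vertices (size l).+1 | merged u w l s) F (lab 1 l s) =
  (cls 1 l u)%:R * F u + (cls 1 l w)%:R * F w.
Proof.
move=> uw; rewrite /cls !natr_sum !mulr_suml -big_split /= big_mkcond /=.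
apply: eq_bigr => s _; rewrite /merged.
case: (lab 1 l s =P u) => [->|_] /=; first by rewrite (negPf uw) mul1r mul0r addr0.
by case: (lab 1 l s =P w) => [->|_] /=; rewrite ?mul1r !mul0r ?add0r ?addr0.
Qed.

Lemma gap_merged (R : realType) u w v l : (1 < u < w)%N ->
  gap R v l = rest R u w v l + (cls 1 l u)%:R ^+ 2 + (cls 1 l w)%:R ^+ 2.
Proof.
move=> uw; have nuw : u != w by lia.
rewrite /gap /rest {1}/same_comp natr_sum (bigID (merged u w l)) /=.
have -> : \sum_(s <- vertices (size l).+1 | (s != 1%N) && merged u w l s)
   (cls 1 l (lab 1 l s))%:R = (cls 1 l u)%:R ^+ 2 + (cls 1 l w)%:R ^+ 2 :> R.
  rewrite !expr2 -(sum_merged _ (fun a => (cls 1 l a)%:R) nuw).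
  apply: eq_bigl => s; case: (s =P 1%N) => [->|//] /=.
  by rewrite merged1.
ring.
Qed.

Lemma msizeE u w l : u != w ->
  msize u w l = (\sum_(s <- vertices (size l).+1) merged u w l s)%N.
Proof.
move=> uw; rewrite /msize /cls -big_split /=; apply: eq_bigr => s _.
rewrite /merged; case: (lab 1 l s =P u) => [->|//] /=.
by rewrite (negPf uw).
Qed.

Lemma msize_redirect n0 u w v l : merge_inv n0 u w v l ->
  msize u w (redirect n0 u w l) = msize u w l.
Proof.
move=> hI; have [uw _] := mi_uw hI; have nuw : u != w by clear -uw; lia.
rewrite !msizeE // size_redirect.
by apply: eq_big_seq => s hs; rewrite (mi_merged hI).
Qed.

Lemma same_comp_redirect n0 u w v l : merge_inv n0 u w v l ->
  same_comp v (redirect n0 u w l) = same_comp v l.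
Proof.
move=> hI; rewrite /same_comp size_redirect big_seq_cond [RHS]big_seq_cond.
apply: eq_bigr => s /andP[hs _]; rewrite /cls size_redirect (mi_labv hI) //.
by apply: eq_big_seq => t ht; rewrite (mi_labv hI).
Qed.

Lemma rest_redirect (R : realType) n0 u w v l : merge_inv n0 u w v l ->
  rest R u w v (redirect n0 u w l) = rest R u w v l.
Proof.
move=> hI; rewrite /rest (same_comp_redirect hI) size_redirect; congr (_ - _).
rewrite big_seq_cond [RHS]big_seq_cond; apply: eq_big => [s|s].
  case hs: (s \in _) => //=.
  by rewrite (mi_merged hI).
move=> /andP[hs]; rewrite (mi_merged hI) // => /andP[_ nm].
rewrite (mi_lab1 hI) //; congr (_%:R); rewrite /cls size_redirect.
apply: eq_big_seq => t ht; case mt: (merged u w l t); last first.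
  by rewrite (mi_lab1 hI) // mt.
have mt' : merged u w (redirect n0 u w l) t by rewrite (mi_merged hI).
(* A merged [t] never has the same label as the unmerged [s], whether before or after redirection,
   so it counts for 0 on both sides. *)
have E x y : merged u w x t -> ~~ merged u w y s -> (lab 1 x t == lab 1 y s) = false.
  by move=> h; apply: contraNF => /eqP e; rewrite /merged -e.
by rewrite !E.
Qed.

Lemma cls_merged_cons u w n0 v l i : merge_inv n0 u w v l ->
  i \in vertices (size l).+1 ->
  (cls 1 (i :: l) u = cls 1 l u + (lab 1 l i == u))%N.
Proof.
move=> hI hi; have [uw wn] := mi_uw hI.
rewrite cls_cons lab_cons_new; have /negPf -> : (size l).+2 != 1%N by [].
case: (i =P 1%N) => [->|//] /=; rewrite lab_self ?mem_vertices //.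
by clear -uw wn; congr (_ + _)%N; lia.
Qed.

Lemma msize_cons u w n0 v l i : merge_inv n0 u w v l ->
  i \in vertices (size l).+1 ->
  (msize u w (i :: l) = msize u w l + merged u w l i)%N.
Proof.
move=> hI hi; have [uw wn] := mi_uw hI; have nuw : u != w by clear -uw; lia.
rewrite !msizeE // -[size (i :: l)]/(size l).+1 sum_verticesS merged_cons_new //.
by congr (_ + _)%N; apply: eq_big_seq => s hs; rewrite merged_cons_old.
Qed.

Lemma redirect_cons n0 u w v l i : merge_inv n0 u w v l ->
  redirect n0 u w (i :: l) =
  (if merged u w l i then u else i) :: redirect n0 u w l.
Proof. by move=> hI; rewrite /= (mi_size hI). Qed.

Arguments redirect : simpl never.

Lemma cls_gt0 v l s : s \in vertices (size l).+1 -> (0 < cls v l (lab v l s))%N.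
Proof.
move=> hs; rewrite /cls lt0n sum_nat_seq_neq0; apply/hasP; exists s => //.
by rewrite eqxx.
Qed.

Lemma merge_inv_gt0 n0 u w v l : merge_inv n0 u w v l ->
  (0 < cls 1 l u)%N /\ (0 < cls 1 l w)%N.
Proof.
move=> hI; have [uw wn] := mi_uw hI.
split; [rewrite -(mi_labu hI)|rewrite -(mi_labw hI)]; apply: cls_gt0;
  by rewrite mem_vertices; clear -uw wn; lia.
Qed.

(* The attachments inside the two merged branches make the size of the first
   one a Polya urn, for which the uniform law on [1, r) is invariant. *)
Definition urn_step (R : realType) (u w : nat) (G : seq nat -> nat -> R)
    (h : seq nat) (y : nat) : R :=
  (size h).+1%:R^-1 *
  (\sum_(i <- vertices (size h).+1 | ~~ merged u w h i) G (i :: h) y +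
   y%:R * G (u :: h) y.+1 + (msize u w h - y)%:R * G (u :: h) y).

(** The mean of [G] when the redirected history is kept and the size of the first branch is redrawn
    uniformly from [1, r), r being the merged size. *)
Definition urn_avg (R : realType) (n0 u w : nat) (G : seq nat -> nat -> R)
    (l : seq nat) : R :=
  ((msize u w l).-1)%:R^-1 *
  \sum_(1 <= y < msize u w l) G (redirect n0 u w l) y.

(** The redirected history and the size of the first branch form a Markov chain: a merged attachment
    always redirects to [u], and the size grows exactly when the true attachment point is in the
    branch of [u]. *)
Lemma step_urn (R : realType) n0 u w v (G : seq nat -> nat -> R) l :
  merge_inv n0 u w v l ->
  step (fun l' => G (redirect n0 u w l') (cls 1 l' u)) l =
  urn_step u w G (redirect n0 u w l) (cls 1 l u).
Proof.
move=> hI; have [uw _] := mi_uw hI; have nuw : u != w by clear -uw; lia.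
rewrite /step /urn_step size_redirect; congr (_ * _).
rewrite (bigID (merged u w l)) /= addrC -addrA; congr (_ + _).
  rewrite big_seq_cond [RHS]big_seq_cond; apply: eq_big => [s|s /andP[hs nm]].
    case hs: (s \in _) => //=.
    by rewrite (mi_merged hI).
  rewrite (redirect_cons _ hI) (negPf nm) (cls_merged_cons hI) //.
  have -> : (lab 1 l s == u) = false.
    by apply: contraNF nm => h; rewrite /merged h.
  by rewrite addn0.
rewrite (msize_redirect hI).
pose F a := G (u :: redirect n0 u w l) (cls 1 l u + (a == u))%N.
transitivity (\sum_(i <- vertices (size l).+1 | merged u w l i) F (lab 1 l i)).
  rewrite big_seq_cond [RHS]big_seq_cond; apply: eq_bigr => i /andP[hi mi].
  by rewrite (redirect_cons _ hI) mi (cls_merged_cons hI).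
rewrite sum_merged // /F eqxx (eq_sym w) (negPf nuw) addn1 addn0.
by rewrite /msize addnC addnK.
Qed.

(** After a merged attachment, size y arises from y-1 with weight y-1 and from y with weight r-y.
    The total r-1 is the same for all y, so uniformity persists. *)
Lemma sum_urn (R : realType) (r : nat) (g : nat -> R) : (0 < r)%N ->
  \sum_(1 <= y < r) (y%:R * g y.+1 + (r - y)%:R * g y) =
  r.-1%:R * \sum_(1 <= y < r.+1) g y.
Proof.
case: r => [//|r] _ /=; rewrite big_split /= mulr_sumr.
have -> : \sum_(1 <= y < r.+1) y%:R * g y.+1 = \sum_(1 <= y < r.+2) (y.-1)%:R * g y.
  rewrite [RHS]big_ltn // mul0r add0r -[2%N]/(1 + 1)%N -[r.+2]addn1 big_addn.
  by rewrite addn1 subn1; apply: eq_bigr => y _; rewrite addn1.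
have -> : \sum_(1 <= y < r.+1) (r.+1 - y)%:R * g y =
    \sum_(1 <= y < r.+2) (r.+1 - y)%:R * g y.
  by rewrite [RHS]big_nat_recr //= subnn mul0r addr0.
rewrite -big_split /=; apply: eq_big_nat => y /andP[y1 y2].
by rewrite -mulrDl -natrD; congr (_%:R * _); lia.
Qed.

(** A merged attachment turns the uniform law on [1, r) into that on [1, r+1), and other attachments
    leave it alone, so averaging commutes with a step. *)
Lemma step_urn_avg (R : realType) n0 u w v (G : seq nat -> nat -> R) l :
  merge_inv n0 u w v l ->
  step (urn_avg n0 u w G) l = urn_avg n0 u w (urn_step u w G) l.
Proof.
move=> hI; have [uw _] := mi_uw hI; have nuw : u != w by clear -uw; lia.
have [cu cw] := merge_inv_gt0 hI.
set r := msize u w l; have r1 : (1 < r)%N by rewrite /r /msize; clear -cu cw; lia.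
set h := redirect n0 u w l.
pose S0 i := \sum_(1 <= y < r) G (i :: h) y.
pose T0 := \sum_(1 <= y < r.+1) G (u :: h) y.
have r0 : (r.-1)%:R != 0 :> R by rewrite pnatr_eq0; clear -r1; lia.
have rr : r%:R != 0 :> R by rewrite pnatr_eq0; clear -r1; lia.
transitivity ((size l).+1%:R^-1 *
   (\sum_(i <- vertices (size l).+1 | ~~ merged u w l i) (r.-1)%:R^-1 * S0 i + T0)).
  rewrite /step; congr (_ * _); rewrite (bigID (merged u w l)) /= addrC.
  congr (_ + _).
    rewrite big_seq_cond [RHS]big_seq_cond; apply: eq_bigr => i /andP[hi nm].
    by rewrite /urn_avg (msize_cons hI) // (redirect_cons _ hI) (negPf nm) addn0.
  transitivity (\sum_(i <- vertices (size l).+1 | merged u w l i)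
      (fun=> r%:R^-1 * T0) (lab 1 l i)).
    rewrite big_seq_cond [RHS]big_seq_cond; apply: eq_bigr => i /andP[hi mi].
    by rewrite /urn_avg (msize_cons hI) // (redirect_cons _ hI) mi addn1.
  by rewrite (sum_merged _ (fun=> r%:R^-1 * T0) nuw) -mulrDl -natrD -/(msize u w l) -/r mulVKf.
rewrite /urn_avg /urn_step -/h -/r size_redirect.
rewrite -!mulr_sumr [RHS]mulrCA; congr (_ * _).
rewrite (msize_redirect hI) -/r.
under [in RHS]eq_bigr => y _ do rewrite -addrA.
rewrite big_split /= sum_urn ?(ltnW r1) // mulrDr mulKf //; congr (_ + _).
congr (_ * _); rewrite [RHS]exchange_big /= /S0.
rewrite big_seq_cond [RHS]big_seq_cond; apply: eq_bigl => i.
case hi: (i \in _) => //=.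
by rewrite /h (mi_merged hI).
Qed.

(** The point mass at the actual size is at most r-1 times the uniform law on [1, r), and later
    steps preserve this domination. *)
Lemma mean_urn (R : realType) n0 u w v k (G : seq nat -> nat -> R) l :
  merge_inv n0 u w v l -> (forall h y, 0 <= G h y) ->
  mean k (fun l' => G (redirect n0 u w l') (cls 1 l' u)) l <=
  ((msize u w l).-1)%:R * mean k (urn_avg n0 u w G) l.
Proof.
elim: k G => [|k IH] G hI G0.
  have [cu cw] := merge_inv_gt0 hI; rewrite /= /urn_avg mulVKf; last first.
    by rewrite pnatr_eq0 /msize; clear -cu cw; lia.
  rewrite (big_rem (cls 1 l u)) /=; last first.
    by rewrite mem_index_iota /msize; clear -cu cw; lia.
  by rewrite lerDl sumr_ge0.
have gI := @growing_merge_inv n0 u w v.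
rewrite /mean !iterSr -!/(mean _ _).
have h1 : mean k (step (fun l' => G (redirect n0 u w l') (cls 1 l' u))) l <=
   mean k (fun l' => urn_step u w G (redirect n0 u w l') (cls 1 l' u)) l.
  by apply: (ler_mean gI hI) => l' _ hI'; rewrite (step_urn _ hI').
apply: (le_trans h1).
apply: (@le_trans _ _ (((msize u w l).-1)%:R * mean k (urn_avg n0 u w (urn_step u w G)) l)).
  apply: IH => // h y; rewrite /urn_step mulr_ge0 ?invr_ge0 ?ler0n //.
  by rewrite !addr_ge0 ?mulr_ge0 ?ler0n // sumr_ge0.
rewrite ler_wpM2l ?ler0n //.
by apply: (ler_mean gI hI) => l' _ hI'; rewrite (step_urn_avg _ hI').
Qed.

Definition urn_ratio (R : realType) (u w : nat) (l : seq nat) : R :=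
  (size l)%:R / ((msize u w l).-1)%:R.

(** Since r grows with probability r/n, the ratio (n-1)/(r-1) is a martingale. It controls the
    density 1/(r-1) at a later time, when r is random. *)
Lemma step_urn_ratio (R : realType) n0 u w v l : merge_inv n0 u w v l ->
  step (urn_ratio R u w) l = urn_ratio R u w l.
Proof.
move=> hI; have [uw wn] := mi_uw hI; have nuw : u != w by clear -uw; lia.
have [cu cw] := merge_inv_gt0 hI.
set r := msize u w l; have r1 : (1 < r)%N by rewrite /r /msize; clear -cu cw; lia.
have r0 : (r.-1)%:R != 0 :> R by rewrite pnatr_eq0; clear -r1; lia.
have rr : r%:R != 0 :> R by rewrite pnatr_eq0; clear -r1; lia.
have n0' : (size l).+1%:R != 0 :> R by rewrite pnatr_eq0.
pose n : R := (size l).+1%:R.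
rewrite /step (eq_big_seq (fun i => n / (r.-1)%:R +
   (n / r%:R - n / (r.-1)%:R) * (merged u w l i)%:R)) => [|i hi]; last first.
  rewrite /urn_ratio (msize_cons hI) // -/r /= -/n.
  by case: (merged u w l i); rewrite ?addn1 ?addn0 ?mulr1 ?mulr0; ring.
rewrite big_split /= big_const_seq count_predT size_iota iter_addr_0.
rewrite -[_ *+ (size l).+1]mulr_natl -mulr_sumr -natr_sum -msizeE // -/r -/n /urn_ratio -/r.
have rE : r%:R = (r.-1)%:R + 1 :> R by rewrite natr1 prednK // ltnW.
have nE : n = (size l)%:R + 1 :> R by rewrite natr1.
rewrite rE nE; field; rewrite -nE -rE r0 rr /=; exact: n0'.
Qed.

(** * Anticoncentration *)

Lemma size_spread (R : realType) (s : seq nat) (t : R) : uniq s -> 0 <= t ->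
  (forall x y, x \in s -> y \in s -> (x <= y)%N -> y%:R - x%:R <= t) ->
  (size s)%:R <= t + 1.
Proof.
move=> us t0 hs; case: s us hs => [|x0 s] us hs; first by rewrite addr_ge0.
have ex : exists x, x \in x0 :: s by exists x0; rewrite inE eqxx.
case: (ex_minnP ex) => a ha amin.
have : (size (x0 :: s) <= size (iota a (Num.truncn t).+1))%N.
  apply: uniq_leq_size => // x hx; rewrite mem_iota (amin x hx) /=.
  have := hs a x ha hx (amin x hx); rewrite -natrB ?amin // => h.
  have : (x - a <= Num.truncn t)%N by rewrite truncn_ge_nat.
  by have := amin x hx; lia.
rewrite size_iota -(ler_nat R) => /le_trans; apply.
by rewrite -natr1 lerD2r truncn_le.
Qed.

(** For two values x <= y in the window, (y-x)|x+y-r| is at most b. On either side of r/2 the second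
    factor is at least y-x, so each side spreads over at most t and holds at most t+1 values. *)
Lemma sum_quadratic_window (R : realType) (a t b : R) r : 0 <= t -> b <= t ^+ 2 ->
  \sum_(1 <= y < r) (`|a + y%:R ^+ 2 + (r - y)%:R ^+ 2| <= b)%R%:R <= 2 * t + 2.
Proof.
move=> t0 bt.
pose P (y : nat) := `|a + y%:R ^+ 2 + (r - y)%:R ^+ 2| <= b.
pose hi y := (r <= 2 * y)%N.
have split y : (P y)%:R = (P y && hi y)%:R + (P y && ~~ hi y)%:R :> R.
  by case: (P y); case: (hi y); rewrite /= ?addr0 ?add0r.
have cnt (p : pred nat) : \sum_(1 <= y < r) (p y)%:R =
    (size [seq y <- index_iota 1 r | p y])%:R :> R.
  rewrite -natr_sum size_filter; congr (_%:R); rewrite -sum1_count [RHS]big_mkcond.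
  by apply: eq_bigr => y _; case: (p y).
have win x y : P x -> P y -> (x < r)%N -> (y < r)%N ->
    (y%:R - x%:R) * (y%:R + x%:R - r%:R) <= t ^+ 2.
  rewrite /P => + + /ltnW xr /ltnW yr; rewrite !natrB // !ler_norml.
  by move=> /andP[h1 h2] /andP[h3 h4]; nra.
under eq_bigr => y _ do rewrite -[_ <= b]/(P y) split.
rewrite big_split /= !cnt.
have h1 : (size [seq y <- index_iota 1 r | P y && hi y])%:R <= t + 1.
  apply: size_spread => // [|x y]; first by rewrite filter_uniq ?iota_uniq.
  rewrite !mem_filter !mem_index_iota => /andP[/andP[px hx] /andP[_ xr]].
  move=> /andP[/andP[py hy] /andP[_ yr]] xy; have := win x y px py xr yr.
  have : r%:R <= 2 * x%:R :> R by rewrite -natrM ler_nat.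
  have : x%:R <= y%:R :> R by rewrite ler_nat.
  move: (x%:R : R) (y%:R : R) (r%:R : R) => X Y S h h' h''.
  by rewrite leNgt; apply/negP => h'''; nra.
have h2 : (size [seq y <- index_iota 1 r | P y && ~~ hi y])%:R <= t + 1.
  apply: size_spread => // [|x y]; first by rewrite filter_uniq ?iota_uniq.
  rewrite !mem_filter !mem_index_iota => /andP[/andP[px hx] /andP[_ xr]].
  move=> /andP[/andP[py hy] /andP[_ yr]] xy; have := win y x py px yr xr.
  have : 2 * y%:R <= r%:R :> R by rewrite -natrM ler_nat; move: hy; rewrite /hi; lia.
  have : x%:R <= y%:R :> R by rewrite ler_nat.
  move: (x%:R : R) (y%:R : R) (r%:R : R) => X Y S h h' h''.
  by rewrite leNgt; apply/negP => h'''; nra.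
by lra.
Qed.

Lemma mean_small_gap (R : realType) n0 u w v k (e : R) l :
  merge_inv n0 u w v l -> 0 <= e ->
  mean k (fun l' => (`|ngap R v l'| <= e ^+ 2)%R%:R) l <=
  (size l)%:R * ((2 * (e * (k + size l).+2%:R) + 2) / (k + size l)%:R).
Proof.
move=> hI e0; have gI := @growing_merge_inv n0 u w v.
have [uw wn] := mi_uw hI; have nuw : u != w by clear -uw; lia.
have sl : (0 < size l)%N by clear -uw wn; lia.
pose b (h : seq nat) : R := e ^+ 2 * ((size h).+1%:R * (size h).+2%:R).
pose G h y : R := (`|rest R u w v h + y%:R ^+ 2 +
  (msize u w h - y)%:R ^+ 2| <= b h)%R%:R.
set C : R := 2 * (e * (k + size l).+2%:R) + 2.
have C0 : 0 <= C by rewrite addr_ge0 // !mulr_ge0.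
apply: (@le_trans _ _ (mean k (fun l' => G (redirect n0 u w l') (cls 1 l' u)) l)).
  apply: (ler_mean gI hI) => l' _ hI'; rewrite /G (rest_redirect _ hI').
  rewrite (msize_redirect hI') /b size_redirect {1}/msize addKn.
  rewrite -(gap_merged _ _ _ uw) /ngap normrM ler_nat.
  rewrite [X in _ * X]ger0_norm ?invr_ge0 ?mulr_ge0 //.
  by rewrite ler_pdivrMr ?mulr_gt0 ?ltr0n.
apply: (le_trans (mean_urn k hI _)) => [h y|]; first exact: ler0n.
have [cu cw] := merge_inv_gt0 hI.
have r0 : (0 < (msize u w l).-1)%N by rewrite /msize; clear -cu cw; lia.
(* At the fixed final size [k + size l], the density 1/(r-1) is [urn_ratio] divided by that size. *)
apply: (@le_trans _ _ (((msize u w l).-1)%:R *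
    (C / (k + size l)%:R * mean k (urn_ratio R u w) l))).
  rewrite ler_wpM2l //.
  rewrite -[leRHS]add0r -mean_affine; apply: (ler_mean gI hI) => l' sl' hI'.
  rewrite add0r /urn_avg /urn_ratio sl' mulrA divfK 1?[leLHS]mulrC; last first.
    by rewrite pnatr_eq0 -lt0n addn_gt0 sl orbT.
  rewrite ler_wpM2r ?invr_ge0 //.
  have -> : msize u w l' = msize u w (redirect n0 u w l') by rewrite (msize_redirect hI').
  apply: sum_quadratic_window; first by rewrite mulr_ge0.
  rewrite /b size_redirect sl' exprMn ler_wpM2l ?sqr_ge0 //.
  by rewrite expr2 -!natrM ler_nat leq_mul.
have hr : mean k (urn_ratio R u w) l <= urn_ratio R u w l.
  by apply: (mean_supermartingale k gI _ hI) => l' hI'; rewrite (step_urn_ratio _ hI').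
apply: (@le_trans _ _ (((msize u w l).-1)%:R *
    (C / (k + size l)%:R * urn_ratio R u w l))).
  by rewrite ler_wpM2l // ler_wpM2l // divr_ge0.
(* The factor r-1 from [mean_urn] cancels against [urn_ratio] at [l], leaving a bound free of the
   branch sizes. *)
rewrite /urn_ratio le_eqVlt; apply/orP; left; apply/eqP.
have : (msize u w l).-1%:R != 0 :> R by rewrite pnatr_eq0 -lt0n.
have : (k + size l)%:R != 0 :> R by rewrite pnatr_eq0 -lt0n addn_gt0 sl orbT.
move: (msize u w l).-1%:R (k + size l)%:R => m N hN hm.
by field; rewrite hm hN.
Qed.

(** * The children of the root *)

Fixpoint kids (l : seq nat) : seq nat :=
  if l is i :: l' then
    if i == 1%N then (size l').+2 :: kids l' else kids l'
  else [::].

Lemma size_kids l : size (kids l) = count_mem 1%N l.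
Proof. by elim: l => [//|i l IH] /=; case: (i =P 1%N) => _ /=; rewrite IH. Qed.

Lemma mem_kids l c : c \in kids l ->
  [/\ (1 < c <= (size l).+1)%N & lab 1 l c = c].
Proof.
elim: l => [//|i l IH] /=.
have old : c \in kids l -> (1 < c <= (size l).+2)%N /\ lab 1 (i :: l) c = c.
  move=> /IH[h1 h2]; split; first by clear -h1; lia.
  by rewrite lab_consE // mem_vertices; clear -h1; lia.
case: (i =P 1%N) => [i1|_] //; rewrite inE => /orP[/eqP ->|]; last exact: old.
by split; [lia | rewrite lab_cons_new i1 orbT].
Qed.

Lemma uniq_kids l : uniq (kids l).
Proof.
elim: l => [//|i l IH] /=; case: ifP => // _; rewrite /= IH andbT.
by apply/negP => /mem_kids[h _]; clear -h; lia.
Qed.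

(** At most one child equals [a]. With [a] the name of the branch of [v], the two others head
    branches that avoid [v]. *)
Lemma kids_pair l a : (2 < count_mem 1%N l)%N ->
  exists u w, [/\ (u < w)%N, u \in kids l, w \in kids l, u != a & w != a].
Proof.
rewrite -size_kids => h.
have : (1 < size [seq c <- kids l | c != a])%N.
  rewrite size_filter; have := count_predC (pred1 a) (kids l).
  rewrite count_uniq_mem ?uniq_kids //; clear -h; move: (count _ _).
  by case: (_ \in _) => /= n; lia.
have us : uniq [seq c <- kids l | c != a] by rewrite filter_uniq ?uniq_kids.
have mem c : c \in [seq c <- kids l | c != a] -> c != a /\ c \in kids l.
  by rewrite mem_filter => /andP[].
case E : [seq c <- kids l | c != a] us mem => [|x [|y s]] //= us mem _.
have [xa xk] := mem x (mem_head _ _).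
have [|ya yk] := mem y; first by rewrite !inE eqxx orbT.
have xy : x != y by move: us; rewrite inE negb_or => /andP[/andP[]].
case: (ltngtP x y) => h'; last by rewrite h' eqxx in xy.
- by exists x, y.
- by exists y, x.
Qed.

(** An attachment multiplies the mean of the power of 1/2 by 1 - 1/(2n), and (1 - 1/(2n))^2 (n+1) is
    at most n. *)
Lemma step_deg_root (R : realType) l :
  step (fun l' => 2^-1 ^+ count_mem 1%N l' * Num.sqrt (size l').+1%:R) l <=
  2^-1 ^+ count_mem 1%N l * Num.sqrt (size l).+1%:R :> R.
Proof.
set n : R := (size l).+1%:R; have n1 : 1 <= n by rewrite ler1n.
have nS : (size l).+2%:R = n + 1 by rewrite /n -natr1.
set d : R := 2^-1 ^+ count_mem 1%N l.
have d0 : 0 <= d by rewrite exprn_ge0.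
rewrite /step -/n (eq_big_seq (fun i => d * Num.sqrt (n + 1) +
  (- (2^-1 * d * Num.sqrt (n + 1))) * (i == 1%N)%:R)) => [|i _]; last first.
  rewrite /= exprD nS -/d; case: (i == 1%N); rewrite /= ?expr1 ?expr0; last by ring.
  by field.
rewrite big_split /= big_const_seq count_predT size_iota iter_addr_0.
rewrite -[_ *+ (size l).+1]mulr_natl -mulr_sumr -natr_sum -/n.
have -> : (\sum_(i <- vertices (size l).+1) (i == 1))%N = 1%N.
  rewrite -(@big_mkcond _ 0%N addn _ _ (fun i => i == 1%N) (fun=> 1%N)).
  by rewrite sum1_count count_uniq_mem ?uniq_vertices // mem_vertices.
have -> : n^-1 * (n * (d * Num.sqrt (n + 1)) + - (2^-1 * d * Num.sqrt (n + 1)) * 1%:R) =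
   d * ((1 - (2 * n)^-1) * Num.sqrt (n + 1)) by field; lra.
rewrite ler_wpM2l // -ler_sqr ?nnegrE; last 2 first.
- rewrite mulr_ge0 ?sqrtr_ge0 // subr_ge0 invf_le1; lra.
- exact: sqrtr_ge0.
rewrite exprMn !sqr_sqrtr; [|lra|lra].
rewrite -subr_ge0.
have -> : n - (1 - (2 * n)^-1) ^+ 2 * (n + 1) = (3 * n - 1) / (4 * n ^+ 2).
  by field; lra.
by rewrite divr_ge0 ?mulr_ge0 ?sqr_ge0 //; lra.
Qed.

(** Markov's inequality for the preceding supermartingale, which starts from 1 and is at least a
    quarter of the square root when the root has at most two children. *)
Lemma mean_deg_root (R : realType) k :
  mean k (fun l => (count_mem 1%N l <= 2)%:R) [::] <=
  4 / Num.sqrt k.+1%:R :> R.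
Proof.
have gT : growing (fun=> True) by [].
have s0 : 0 < Num.sqrt (k.+1%:R : R) by rewrite sqrtr_gt0 ltr0n.
pose f l : R := 2^-1 ^+ count_mem 1%N l * Num.sqrt (size l).+1%:R.
apply: (@le_trans _ _ (4 / Num.sqrt k.+1%:R * mean k f [::])).
  rewrite -[leRHS]add0r -mean_affine; apply: (ler_mean gT I) => l sl _.
  rewrite add0r /f sl addn0 [_ ^+ _ * _]mulrC mulrA divfK ?gt_eqF //.
  set c := count_mem _ _; case: (leqP c 2) => h /=.
    by case: c h => [|[|[|]]] // _; rewrite ?expr0 ?expr1 ?expr2; lra.
  by rewrite mulr_ge0 ?exprn_ge0.
rewrite -[leRHS]mulr1 ler_wpM2l ?divr_ge0 ?(ltW s0) //.
apply: (@le_trans _ _ (f [::])); last by rewrite /f /= expr0 mul1r sqrtr1.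
by apply: (mean_supermartingale k gT _ I) => l _; exact: step_deg_root.
Qed.

(** * Probability bounds along finite histories *)

Lemma mean_cst (R : realType) (c : R) k l : mean k (fun=> c) l = c.
Proof.
elim: k l => [//|k IH] l; rewrite /mean iterS.
rewrite (@eq_step _ _ (fun l' => c + 0 * 0)) => [|i _]; last first.
  by rewrite mul0r addr0; exact: IH.
by rewrite step_affine mul0r addr0.
Qed.

Lemma mean_indic_le1 (R : realType) (A : pred (seq nat)) k l :
  mean k (fun l' => (A l')%:R) l <= 1 :> R.
Proof.
apply: (@le_trans _ _ (mean k (fun=> 1) l)); last by rewrite mean_cst.
apply: (@ler_mean _ (fun=> True)) => // l' _ _.
by rewrite lern1 leq_b1.
Qed.

(** With fewer than three children the bound 1 is used; otherwise two branches avoiding [v] are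
    merged. For N = [k + size l], the hypotheses N >= 2 and eN >= 1 give (2e(N+2)+2)/N <= 6e. *)
Lemma mean_small_gap_deg (R : realType) v k (e : R) l :
  v != 1%N -> (v <= (size l).+1)%N -> valid l -> 0 < e ->
  (1 < k + size l)%N -> 1 <= e * (k + size l)%:R ->
  mean k (fun l' => (`|ngap R v l'| <= e ^+ 2)%R%:R) l <=
  (count_mem 1%N l <= 2)%N%:R + 6 * e * (size l)%:R.
Proof.
move=> v1 vn hl e0 kn he; case: (leqP (count_mem 1%N l) 2) => hd.
  apply: (le_trans (mean_indic_le1 _ _ _ _)).
  by rewrite lerDl !mulr_ge0 // ltW.
have [u [w [uw /mem_kids[hu lu] /mem_kids[hw lw] ua wa]]] := kids_pair (lab 1 l v) hd.
have hI : merge_inv (size l) u w v l.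
  apply: merge_inv_init => //.
  - by clear -uw hu; lia.
  - by clear -hw; lia.
  - by rewrite /merged eq_sym (negPf ua) eq_sym (negPf wa).
apply: (le_trans (mean_small_gap k hI (ltW e0))).
rewrite add0r [leRHS]mulrC ler_wpM2l //.
set N : R := (k + size l)%:R in he *.
have N2 : 2 <= N by rewrite /N ler_nat.
have -> : (k + size l).+2%:R = N + 2 by rewrite /N -!natr1; ring.
by rewrite ler_pdivrMr; nra.
Qed.

Definition small_gap (R : realType) v (d : R) : pred (seq nat) :=
  fun l => `|ngap R v l| <= d.

(** From above [2 * d], reaching [d] takes a displacement of at least [d]; the maximal inequality is
    applied to the compensated squared displacement over [d ^+ 2]. *)
Lemma mean_visits_small_gap (R : realType) v k (d : R) l :
  (v <= (size l).+1)%N -> valid l -> 0 < d ->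
  mean k (fun l' => (visits (small_gap v d) (size l) l')%:R) l <=
  (`|ngap R v l| <= 2 * d)%R%:R + 4 / (size l).+2%:R / d ^+ 2.
Proof.
move=> vn hl d0; have d2 : 0 < d ^+ 2 by rewrite exprn_gt0.
have [hs|hs] := leP _ (2 * d).
  apply: (le_trans (mean_indic_le1 _ _ _ _)).
  by rewrite lerDl !divr_ge0 ?sqr_ge0 //.
set c := ngap R v l in hs *.
pose f l' := 0 + (d ^+ 2)^-1 * ((ngap R v l' - c) ^+ 2 + 4 / (size l').+2%:R).
apply: (@le_trans _ _ (f l)); last first.
  by rewrite /f -/c subrr expr0n /= !add0r mulrC.
apply: (maximal_inequality k (@growing_valid v)) => //.
- move=> l' [hl' vn']; rewrite /f step_affine lerD2l ler_wpM2l ?invr_ge0 ?(ltW d2) //.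
  exact: step_ngap_sqr.
- by move=> l' _; rewrite /f add0r mulr_ge0 ?invr_ge0 ?(ltW d2) // addr_ge0 ?sqr_ge0 // divr_ge0.
move=> l' _ hA; have {}hA : `|ngap R v l'| <= d := hA; rewrite /f add0r.
rewrite mulrC ler_pdivlMr // mul1r.
have : 0 <= 4 / (size l').+2%:R :> R by rewrite divr_ge0.
have : d <= `|ngap R v l' - c|.
  have := ler_normB (ngap R v l') (ngap R v l' - c).
  by rewrite opprB addrCA subrr addr0; lra.
rewrite -[(ngap R v l' - c) ^+ 2](real_normK (num_real _)).
by move: (4 / _) `|_ - _| => x y; nra.
Qed.

(** Three failures cost e/3 each: too few children of the root at time [n0], a normalized gap within
    [2 * d] at time [m], and a later return to within [d]. *)
Lemma gap_nonvanishing (R : realType) v (e : R) : v != 1%N -> 0 < e ->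
  exists (d : R) m, [/\ 0 < d, (v <= m.+1)%N &
    forall k, mean (m + k) (fun l => (visits (small_gap v d) m l)%:R) [::] <= e].
Proof.
move=> v1 e0.
have gv := @growing_valid.
pose n0 := maxn (maxn v 2) (Num.truncn ((12 / e) ^+ 2)).+1.
have n0v : (v <= n0)%N by rewrite /n0; lia.
have n02 : (2 <= n0)%N by rewrite /n0; lia.
have hn0 : 4 / Num.sqrt n0.+1%:R <= e / 3.
  have h : (12 / e) ^+ 2 <= n0.+1%:R.
    apply: ltW; apply: (lt_le_trans (truncnS_gt _)).
    by rewrite ler_nat /n0 leqW // leq_maxr.
  have s0 : 0 < Num.sqrt (n0.+1%:R : R) by rewrite sqrtr_gt0.
  have h' : 12 / e <= Num.sqrt n0.+1%:R.
    apply: (le_trans (ler_norm _)).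
    by rewrite -sqrtr_sqr ler_wsqrtr.
  rewrite ler_pdivrMr //; rewrite ler_pdivrMr // in h'.
  by move: h'; set s := Num.sqrt _; lra.
have n0R : 0 < n0%:R :> R by rewrite ltr0n; lia.
(* The factor 18 makes [6 * y * n0%:R] equal to e/3; below, [d] is chosen so that [2 * d] is
   [y ^+ 2]. *)
pose y := e / (18 * n0%:R).
have y0 : 0 < y by rewrite divr_gt0 // mulr_gt0.
pose d := y ^+ 2 / 2.
have d0 : 0 < d by rewrite divr_gt0 // exprn_gt0.
have d2 : 0 < d ^+ 2 by rewrite exprn_gt0.
(* The first bound makes the window [y] wide enough for anticoncentration, the second makes the
   probability of a return at most e/3. *)
pose k0 := (maxn (Num.truncn y^-1) (Num.truncn (12 / e / d ^+ 2))).+1.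
pose m := (n0 + k0)%N.
have hy : 1 <= y * (k0 + n0)%:R.
  rewrite mulrC -ler_pdivrMr // div1r ltW // (lt_le_trans (truncnS_gt _)) //.
  by rewrite ler_nat /k0; move: (Num.truncn _) (Num.truncn _) => t1 t2; clear; lia.
have hm : 4 / m.+2%:R / d ^+ 2 <= e / 3.
  have h : 12 / e / d ^+ 2 <= m.+2%:R.
    rewrite ltW // (lt_le_trans (truncnS_gt _)) //.
    rewrite ler_nat ltnS leqW // /m /k0 addnS leqW //.
    exact: leq_trans (leq_maxr _ _) (leq_addl _ _).
  have mR : 0 < m.+2%:R :> R by [].
  rewrite ler_pdivrMr // ler_pdivrMr //.
  by move: h; rewrite ler_pdivrMr // ler_pdivrMr //; lra.
have vm : (v <= m.+1)%N := leqW (leq_trans n0v (leq_addr _ _)).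
exists d, m; split => //.
move=> k; rewrite mean_add.
have gI := gv 0%N; have I0 : valid [::] /\ (0 <= (size ([::] : seq nat)).+1)%N by [].
set b := 4 / m.+2%:R / d ^+ 2 in hm.
apply: (@le_trans _ _ (mean m (fun l => b + 1 * (`|ngap R v l| <= y ^+ 2)%R%:R) [::])).
  apply: (ler_mean gI I0) => l; rewrite addn0 => sl [hl _]; rewrite mul1r addrC /b -sl.
  have -> : y ^+ 2 = 2 * d by rewrite /d; field.
  by apply: mean_visits_small_gap => //; rewrite sl.
rewrite mean_affine mul1r /m mean_add.
have : mean n0 (mean k0 (fun l => (`|ngap R v l| <= y ^+ 2)%R%:R)) [::] <=
   mean n0 (fun l => 6 * y * n0%:R + 1 * (count_mem 1%N l <= 2)%N%:R) [::].
  apply: (ler_mean gI I0) => l; rewrite addn0 => sl [hl _]; rewrite mul1r addrC -sl.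
  apply: mean_small_gap_deg => //; rewrite ?sl //; first exact: leqW.
  exact: leq_trans n02 (leq_addl _ _).
rewrite mean_affine mul1r.
have : 6 * y * n0%:R = e / 3 by rewrite /y; field; rewrite ?gt_eqF.
have := mean_deg_root R n0.
by move: (mean _ _ _) (mean _ _ _) => a1 a2; lra.
Qed.

(** The history has length [v.-1] when [v] is born; its subtree then has size 1, so [nbelow] starts
    from 2/(v(v+1)). *)
Lemma mean_visits_below (R : realType) v k (e : R) : (1 < v)%N -> 0 < e ->
  mean (v.-1 + k)
    (fun l => (visits (fun l' => e <= nbelow R v l') v.-1 l)%:R) [::] <=
  2 / e * (v%:R * v.+1%:R)^-1.
Proof.
move=> v1 e0; rewrite mean_add.
rewrite -[leRHS](mean_cst _ v.-1 [::]).
have I0 : valid [::] /\ (0 <= (size ([::] : seq nat)).+1)%N by [].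
apply: (ler_mean (@growing_valid 0) I0) => l; rewrite addn0 => sl [hl _].
pose f l' := 0 + e^-1 * nbelow R v l'.
have -> : 2 / e * (v%:R * v.+1%:R)^-1 = f l.
  rewrite /f /nbelow (below_birth hl v1 sl) sl (ltn_predK v1) add0r mul1r.
  by rewrite mulrA [_^-1 * _]mulrC.
rewrite -sl; apply: (maximal_inequality k (@growing_valid v)).
- move=> l' [hl' vn']; rewrite /f step_affine step_nbelow //.
  by rewrite v1.
- by move=> l' _; rewrite /f add0r mulr_ge0 ?invr_ge0 ?(ltW e0) // divr_ge0 // mulr_ge0.
- by move=> l' _ h; rewrite /f add0r mulrC ler_pdivlMr // mul1r.
- by split => //; rewrite sl (ltn_predK v1).
Qed.

(** * Almost sure statements *)

(** [f k] is the attachment point of vertex [k.+1]; the value [f 0] is never read. *)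
Fixpoint hist (f : nat -> nat) (k : nat) : seq nat :=
  if k is k'.+1 then f k'.+1 :: hist f k' else [::].

Lemma size_hist f k : size (hist f k) = k.
Proof. by elim: k => [//|k /= ->]. Qed.

Lemma valid_hist f k : (forall n, (0 < n)%N -> f n \in vertices n) ->
  valid (hist f k).
Proof. by move=> hf; elim: k => [//|k IH] /=; rewrite IH size_hist hf. Qed.

(** Stated for any measurable structure, so as to apply both to [Omega] and to the sigma-algebra of
    the past. *)
Lemma measurable_hist d (T : measurableType d) (V : nat -> T -> nat) n
    (A : pred (seq nat)) :
  (forall k (B : set nat), (0 < k < n.+1)%N -> measurable (V k @^-1` B)) ->
  measurable [set w | A (hist (V^~ w) n)].
Proof.
elim: n A => [|n IH] A mV.
  rewrite /=; case: (A [::]); first by rewrite (_ : [set _ | _] = setT) //; apply/seteqP; split.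
  by rewrite (_ : [set _ | _] = set0) //; apply/seteqP; split.
have -> : [set w | A (hist (V^~ w) n.+1)] =
    \bigcup_i (V n.+1 @^-1` [set i] `&` [set w | A (i :: hist (V^~ w) n)]).
  apply/seteqP; split => [w /= hA|w [i _ /= [<-]]//].
  by exists (V n.+1 w).
apply: bigcupT_measurable => i; apply: measurableI; first by apply: mV; rewrite ltnSn.
apply: (IH (fun l => A (i :: l))) => k B /andP[k0 kn]; apply: mV.
by rewrite k0 ltnW.
Qed.

Lemma mean_step_sum (R : realType) (F : nat -> seq nat -> R) k (s : seq nat) l :
  mean k (fun l' => \sum_(i <- s) F i l') l = \sum_(i <- s) mean k (F i) l.
Proof.
elim: k l => [//|k IH] l; rewrite /mean iterS.
rewrite (@eq_step _ _ (fun l' => \sum_(i <- s) mean k (F i) l')) => [|i _]; last exact: IH.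
by rewrite /step exchange_big /= mulr_sumr; apply: eq_bigr.
Qed.

Section urrt.
Context d (Omega : measurableType d) (R : realType) (P : probability Omega R).
Context (U : nat -> {RV P >-> nat}).
Context (Uv : forall n w, (0 < n)%N -> U n w \in vertices n).
Context (Uunif : forall n i, (0 < n)%N -> i \in vertices n ->
  P (U n @^-1` [set i]) = (n%:R^-1)%:E).
Context (Uind : forall n (A : set nat) E, (0 < n)%N -> past U n E ->
  P (U n @^-1` A `&` E) = (P (U n @^-1` A) * P E)%E).

Definition history (n : nat) (w : Omega) : seq nat := hist (fun k => U k w) n.

Lemma measurable_history n (A : pred (seq nat)) :
  measurable [set w | A (history n w)].
Proof.
apply: (@measurable_hist _ _ (fun k w => U k w)) => k B _.
by rewrite -[X in measurable X]setTI; exact: measurable_funP.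
Qed.

Lemma past_history n (A : pred (seq nat)) :
  past U n.+1 [set w | A (history n w)].
Proof.
rewrite /past; set G := [set E | _].
have : @measurable _ (g_sigma_algebraType G) [set w | A (history n w)].
  apply: (@measurable_hist _ (g_sigma_algebraType G) (fun k w => U k w)) => k B hk.
  by apply: sub_sigma_algebra; exists k, B.
by [].
Qed.

Lemma probability_split (E : set Omega) (V : Omega -> nat) n :
  measurable E -> (forall i, measurable (V @^-1` [set i])) ->
  (P (E `&` [set w | (0 < V w <= n)%N]) <=
   \sum_(i <- vertices n) P (V @^-1` [set i] `&` E))%E.
Proof.
move=> mE mV; elim: n => [|n IH].
  rewrite big_nil (_ : _ `&` _ = set0) ?measure0 //.
  by apply/seteqP; split => // w [_ /=]; lia.
have mn m : measurable (E `&` [set w | (0 < V w <= m)%N]).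
  apply: measurableI => //.
  rewrite (_ : [set w | _] = \bigcup_(i in [set i | (0 < i <= m)%N]) (V @^-1` [set i])).
    by apply: bigcup_measurable.
  by apply/seteqP; split => [w /= h|w [i /= h ->]//]; exists (V w).
rewrite verticesS -cats1 big_cat big_seq1 /=.
apply: le_trans (leeD2r _ IH).
apply: le_trans (measureU2 _ _ _) => //; last by apply: measurableI.
apply: le_measure; rewrite ?inE //; first by apply: measurableU => //; apply: measurableI.
move=> w [hE /= hV]; case: (V w =P n.+1) => h; first by right.
by left; split => //=; lia.
Qed.

(** Splitting by the last attachment, independence from the past and uniformity turn each value [i]
    into one term of the average. *)
Lemma probability_history n (A : pred (seq nat)) :
  (P [set w | A (history n w)] <= (mean n (fun l => (A l)%:R) [::])%:E)%E.
Proof.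
elim: n A => [|n IH] A.
  rewrite /history /=; case: (A [::]) => /=.
    have -> : [set _ : Omega | true] = setT by apply/seteqP; split.
    by rewrite probability_setT.
  have -> : [set _ : Omega | false] = set0 by apply/seteqP; split.
  by rewrite measure0.
have mV i : measurable (U n.+1 @^-1` [set i]).
  by rewrite -[X in measurable X]setTI; exact: measurable_funP.
have -> : [set w | A (history n.+1 w)] =
    [set w | A (history n.+1 w)] `&` [set w | (0 < U n.+1 w <= n.+1)%N].
  apply/seteqP; split => [w hA|w []//]; split => //=.
  by rewrite -mem_vertices Uv.
apply: le_trans (probability_split n.+1 (measurable_history _ _) mV) _.
have term i : i \in vertices n.+1 ->
  (P (U n.+1 @^-1` [set i] `&` [set w | A (history n.+1 w)]) <=
   (n.+1%:R^-1 * mean n (fun l => (A (i :: l))%:R) [::])%:E)%E.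
  move=> hi.
  have -> : U n.+1 @^-1` [set i] `&` [set w | A (history n.+1 w)] =
      U n.+1 @^-1` [set i] `&` [set w | A (i :: history n w)].
    by apply/seteqP; split => w [/= e hA]; split => //; move: hA; rewrite /history /= e.
  rewrite (Uind [set i] (ltn0Sn n) (past_history (n := n) (fun l => A (i :: l)))).
  rewrite Uunif // EFinM lee_wpmul2l ?lee_fin ?invr_ge0 //.
  exact: IH.
apply: (@le_trans _ _ (\sum_(i <- vertices n.+1)
   (n.+1%:R^-1 * mean n (fun l => (A (i :: l))%:R) [::])%:E)%E).
  by rewrite big_seq [leRHS]big_seq; apply: lee_sum.
rewrite sumEFin lee_fin /mean iterSr -!/(mean _ _) -mulr_sumr -mean_step_sum.
rewrite -[leLHS]add0r -mean_affine.
apply: (@ler_mean _ (fun=> True)) => // l sl _.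
by rewrite add0r /step sl addn0.
Qed.

(** The events of a visit by time [m + k] increase with [k], so a bound uniform in [k] passes to
    their union. *)
Lemma probability_visits (A : pred (seq nat)) m (e : R) :
  (forall k, mean (m + k) (fun l => (visits A m l)%:R) [::] <= e) ->
  exists2 B : set Omega, measurable B & (P B <= e%:E)%E /\
    forall w k, (m <= k)%N -> A (history k w) -> B w.
Proof.
move=> he; pose F k := [set w | visits A m (history (m + k) w)].
have mF k : measurable (F k) by exact: measurable_history.
have ndF : nondecreasing_seq F.
  apply/nondecreasing_seqP => k; apply/subsetPset => w.
  by rewrite /F /= addnS /history /= => ->; rewrite orbT.
exists (\bigcup_k F k); first exact: bigcupT_measurable.
split; last first.
  move=> w k mk hA; exists (k - m)%N => //; rewrite /F /= subnKC //.
  move: hA; case: k mk => [|k] mk; rewrite /history /= ?size_hist.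
    by move: mk; rewrite leqn0 => /eqP -> ->.
  by rewrite mk => ->.
have cF : P \o F @ \oo --> P (\bigcup_k F k).
  exact: nondecreasing_cvg_mu (bigcupT_measurable F mF) ndF.
rewrite -(cvg_lim _ cF) //; apply: lime_le; first by apply/cvg_ex; eexists; exact: cF.
apply: nearW => k /=; apply: (le_trans (probability_history _ _)).
by rewrite lee_fin.
Qed.

Lemma negligible_approx (Z : set Omega) :
  (forall e : R, 0 < e -> exists2 B : set Omega, measurable B &
     (P B <= e%:E)%E /\ Z `<=` B) -> P.-negligible Z.
Proof.
move=> h.
have /choice[B hB] : forall n : nat, exists B : set Omega,
    [/\ measurable B, (P B <= (n.+1%:R^-1)%:E)%E & Z `<=` B].
  by move=> n; have [|B mB [h1 h2]] := h n.+1%:R^-1; [rewrite invr_gt0|exists B].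
have mB : measurable (\bigcap_n B n).
  by apply: bigcapT_measurable => n; have [] := hB n.
exists (\bigcap_n B n); split => //; last first.
  by move=> w Zw n _; have [_ _] := hB n; exact.
apply/eqP; rewrite eq_le measure_ge0 andbT; apply/lee_addgt0Pr => e e0.
rewrite add0e; pose n := Num.truncn e^-1.
have [mBn Pn _] := hB n.
apply: (@le_trans _ _ (P (B n))).
  by apply: le_measure; rewrite ?inE // => w; exact.
apply: (le_trans Pn); rewrite lee_fin -[leRHS]invrK lef_pV2 ?posrE ?invr_gt0 //.
exact/ltW/truncnS_gt.
Qed.

Lemma ae_gap v : v != 1%N ->
  {ae P, forall w, exists (e : R) m, 0 < e /\
    forall k, (m <= k)%N -> e < `|ngap R v (history k w)|}.
Proof.
move=> v1; apply: negligible_approx => e e0.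
have [c [m [c0 _ hm]]] := gap_nonvanishing v1 e0.
have [B mB [PB hB]] := probability_visits hm.
exists B => //; split => // w; apply: contra_notP => nB.
exists c, m; split => // k mk; rewrite ltNge; apply/negP => hs.
exact/nB/(hB w k mk).
Qed.

Lemma sum_inv_pronic (n : nat) :
  \sum_(0 <= j < n) (j.+2%:R * j.+3%:R)^-1 = 2^-1 - n.+2%:R^-1 :> R.
Proof.
elim: n => [|n IH]; first by rewrite big_nil subrr.
rewrite big_nat_recr //= IH -!natr1; field.
by rewrite !natr1 !pnatr_eq0.
Qed.

Lemma ae_below (e : R) : 0 < e ->
  {ae P, forall w, exists m, forall v k, (m <= v)%N -> (v <= k.+1)%N ->
    nbelow R v (history k w) < e}.
Proof.
move=> e0.
(* The index [j] stands for the vertex [j.+2], since only vertices other than the root have a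
   subtree measured by [below]. *)
have /choice[B hB] : forall j : nat, exists B : set Omega, [/\ measurable B,
    (P B <= (2 / e * (j.+2%:R * j.+3%:R)^-1)%:E)%E &
    forall w k, (j.+1 <= k)%N -> e <= nbelow R j.+2 (history k w) -> B w].
  move=> j; have := fun k => @mean_visits_below R j.+2 k e isT e0.
  move=> /probability_visits[B mB [PB hB]].
  by exists B; split.
exists (lim_sup_set B); split.
- apply: bigcapT_measurable => n; apply: bigcup_measurable => j _.
  by have [] := hB j.
- apply: lim_sup_set_cvg0 => [j|]; first by have [] := hB j.
  apply: (@le_lt_trans _ _ (2 / e * 2^-1)%:E); last exact: ltry.
  apply: lime_le; first exact: is_cvg_nneseries.
  apply: nearW => n.
  apply: (@le_trans _ _ (\sum_(0 <= j < n) (2 / e * (j.+2%:R * j.+3%:R)^-1)%:E)%E).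
    by apply: lee_sum => j _; have [] := hB j.
  rewrite sumEFin lee_fin -mulr_sumr sum_inv_pronic ler_wpM2l ?divr_ge0 ?(ltW e0) //.
  by rewrite gerBl invr_ge0.
move=> w /= hw n _; apply: contrapT => hn; apply: hw.
exists (maxn n 2).+2 => v k mv vk; rewrite ltNge; apply/negP => hs.
apply: hn; exists v.-2; first by rewrite /=; lia.
have vE : v = v.-2.+2 by lia.
have [_ _ h] := hB v.-2; apply: (h w k); first lia.
by rewrite -vE.
Qed.

End urrt.

(** * Persistence *)

Lemma same_comp_le_gap (R : realType) v l :
  (same_comp v l <= same_comp 1 l)%N = (0 <= gap R v l).
Proof. by rewrite /gap subr_ge0 ler_nat. Qed.

Lemma ngap_lt (R : realType) v l (c : R) :
  (c < `|ngap R v l|) = (c * ((size l).+1%:R * (size l).+2%:R) < `|gap R v l|).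
Proof.
rewrite /ngap normrM [X in _ * X]ger0_norm ?invr_ge0 ?mulr_ge0 //.
by rewrite ltr_pdivlMr ?mulr_gt0.
Qed.

(* A gap of order n^2 whose steps are at most 2n cannot change sign. *)
Lemma sign_eventually_constant (R : realType) (f : nat -> nat) v (c : R) m :
  (forall n, (0 < n)%N -> f n \in vertices n) -> 0 < c ->
  (forall k, (m <= k)%N -> c < `|ngap R v (hist f k)|) ->
  exists M, forall k, (M <= k)%N ->
    (same_comp v (hist f k) <= same_comp 1 (hist f k))%N =
    (same_comp v (hist f M) <= same_comp 1 (hist f M))%N.
Proof.
move=> hf c0 hc; pose M := maxn (maxn m v) (Num.truncn c^-1).
have mM : (m <= M)%N by rewrite /M !leq_max leqnn.
have vM : (v <= M)%N by rewrite /M !leq_max leqnn orbT.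
have cM : (Num.truncn c^-1 <= M)%N by rewrite /M !leq_max leqnn orbT.
exists M => k; elim: k => [|k IH]; first by rewrite leqn0 => /eqP ->.
rewrite leq_eqVlt => /orP[/eqP ->//|Mk]; rewrite -IH // !(same_comp_le_gap R).
have h1 := hc k (leq_trans mM Mk); have h2 := hc k.+1 (leqW (leq_trans mM Mk)).
rewrite ngap_lt size_hist in h1; rewrite ngap_lt size_hist in h2.
have hl := valid_hist k hf.
have hi : f k.+1 \in vertices (size (hist f k)).+1 by rewrite size_hist hf.
have hv : (v <= (size (hist f k)).+1)%N by rewrite size_hist leqW // (leq_trans vM).
have gE := gap_cons R hl hv hi.
have := link_sub_le R v (hist f k) (f k.+1).
move: h1 h2; rewrite /= gE size_hist.
move: (gap R v (hist f k)) ((link _ _ _)%:R - _) => g x.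
set n : R := k.+1%:R.
have n1 : 1 <= n by rewrite ler1n.
have -> : k.+2%:R = n + 1 by rewrite /n -natr1.
have -> : k.+3%:R = n + 2 by rewrite /n -!natr1; ring.
(* Consecutive gaps then exceed n+1 and n+2 in absolute value, so a change of sign would need a jump
   larger than 2n. *)
have cn : 1 <= c * n.
  rewrite mulrC -ler_pdivrMr // div1r ltW // (lt_le_trans (truncnS_gt _)) //.
  by rewrite ler_nat ltnS (leq_trans cM).
have : n + 1 <= c * (n * (n + 1)) by rewrite mulrA ler_peMl //; lra.
have : n + 2 <= c * ((n + 1) * (n + 2)).
  by rewrite mulrA ler_peMl //; [lra | rewrite mulrDr; lra].
rewrite ler_norml => b2 b1 h1 h2 /andP[x1 x2].
have h1' := le_lt_trans b1 h1; have h2' := le_lt_trans b2 h2.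
apply/idP/idP => hg.
  rewrite leNgt; apply/negP => hn; move: h1' h2'.
  by rewrite (ltr0_norm hn) (ger0_norm hg); lra.
rewrite leNgt; apply/negP => hn; move: h1' h2'.
by rewrite (ltr0_norm hn) (ger0_norm hg); lra.
Qed.

Lemma uniform_threshold (Q : nat -> nat -> Prop) b :
  (forall v, (v < b)%N -> exists M, forall k, (M <= k)%N -> Q v k) ->
  exists M, forall v k, (v < b)%N -> (M <= k)%N -> Q v k.
Proof.
elim: b => [|b IH] h; first by exists 0%N.
have [|M hM] := IH; first by move=> v vb; apply: h; exact: leqW.
have [M' hM'] := h b (ltnSn b).
exists (maxn M M') => v k; rewrite ltnS leq_eqVlt geq_max => /orP[/eqP ->|vb] /andP[h1 h2].
  exact: hM'.
exact: hM.
Qed.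

Lemma count_vertices (p : pred nat) m n : (m <= n)%N ->
  (forall u, (m < u <= n)%N -> ~~ p u) ->
  count p (vertices n) = count p (vertices m).
Proof.
move=> mn hp; rewrite /vertices -{1}(subnKC mn) iotaD count_cat.
rewrite [X in (_ + X)%N](_ : _ = 0%N) ?addn0 //.
apply/eqP; rewrite -leqn0 leqNgt -has_count; apply/hasPn => u.
by rewrite mem_iota => hu; apply: hp; lia.
Qed.

Lemma rank_eventually_constant (R : realType) (f : nat -> nat) :
  (forall n, (0 < n)%N -> f n \in vertices n) ->
  (forall v, v != 1%N -> exists (c : R) m, 0 < c /\
     forall k, (m <= k)%N -> c < `|ngap R v (hist f k)|) ->
  (forall j : nat, exists m, forall v k, (m <= v)%N -> (v <= k.+1)%N ->
     nbelow R v (hist f k) < j.+1%:R^-1) ->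
  exists n, forall k, (n <= k)%N ->
    rank (edge (hist f k)) k.+1 1 = rank (edge (hist f n)) n.+1 1.
Proof.
move=> hf hgap hbelow.
(* The fictitious vertex 0 has Q(0) = n^2, so this bounds n^2 - Q(1) below by c n(n+1). *)
have [c [m0 [c0 h0]]] := hgap 0%N isT.
pose j := Num.truncn ((c / 2) ^+ 2)^-1.
have d0 : 0 < (c / 2) ^+ 2 by rewrite exprn_gt0 // divr_gt0.
have hj : j.+1%:R^-1 <= (c / 2) ^+ 2.
  by rewrite -[leRHS]invrK lef_pV2 ?posrE ?invr_gt0 //; exact/ltW/truncnS_gt.
have [m1 h1] := hbelow j.
pose b := maxn m1 2.
have far v k : (b <= v)%N -> (v <= k.+1)%N -> (m0 <= k)%N ->
    ~~ (same_comp v (hist f k) <= same_comp 1 (hist f k))%N.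
  move=> bv vk mk; rewrite -ltnNge.
  have hl := valid_hist k hf.
  have v1 : (1 < v)%N by rewrite (leq_trans _ bv) // /b leq_max orbT.
  have hv : (1 < v <= (size (hist f k)).+1)%N by rewrite v1 size_hist.
  have := same_comp_below hl hv; rewrite -(ler_nat R) natrM natrD !natrM => sb.
  have hb : nbelow R v (hist f k) < (c / 2) ^+ 2.
    apply: lt_le_trans hj; apply: h1 => //; apply: leq_trans bv.
    by rewrite /b leq_max leqnn.
  have := h0 k mk; rewrite ngap_lt /gap same_comp0 // natrM -(ltr_nat R).
  have := same_comp_le 1 (hist f k); rewrite -(ler_nat R) natrM.
  move: hb; rewrite /nbelow; move: sb; rewrite size_hist.
  set n : R := k.+1%:R; have n1 : 1 <= n by rewrite ler1n.
  have -> : k.+2%:R = n + 1 by rewrite /n -natr1.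
  have -> : (below v (hist f k)).+1%:R = (below v (hist f k))%:R + 1 :> R by rewrite -natr1.
  have : 0 <= (below v (hist f k))%:R :> R by [].
  move: ((below v (hist f k))%:R : R) => s s0 sb.
  rewrite ltr_pdivrMr; last by rewrite mulr_gt0; lra.
  move=> hs hle; rewrite ler0_norm ?subr_le0 // opprB => hc.
  (* Here S^2 <= S(S+1) < (c/2)^2 n(n+1). Then n^2 - Q(v) <= 2nS < c n(n+1) < n^2 - Q(1), which
     places [v] after the root. *)
  have hs' : s < c / 2 * (n + 1).
    rewrite -ltr_sqr ?nnegrE //; last by rewrite mulr_ge0 ?divr_ge0 ?(ltW c0) //; lra.
    rewrite exprMn; have hq : (c / 2) ^+ 2 * (n * (n + 1)) <= (c / 2) ^+ 2 * (n + 1) ^+ 2.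
      rewrite ler_wpM2l ?(ltW d0) //.
      have -> : (n + 1) ^+ 2 = n * (n + 1) + (n + 1) by ring.
      by lra.
    apply: (@le_lt_trans _ _ (s * (s + 1))); last exact: lt_le_trans hs hq.
    by rewrite expr2 ler_wpM2l //; lra.
  have : 2 * n * s < 2 * n * (c / 2 * (n + 1)) by rewrite ltr_pM2l ?mulr_gt0 //; lra.
  by lra.
(* [beta v] tells whether [v] eventually precedes the root. *)
have /choice[beta hbeta] : forall v : nat, exists beta : bool, v != 1%N ->
    exists M, forall k, (M <= k)%N ->
      (same_comp v (hist f k) <= same_comp 1 (hist f k))%N = beta.
  move=> v; have [->|v1] := eqVneq v 1%N; first by exists true.
  have [cv [mv [cv0 hv]]] := hgap v v1.
  have [M hM] := sign_eventually_constant hf cv0 hv.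
  by exists (same_comp v (hist f M) <= same_comp 1 (hist f M))%N; exists M.
have [M hM] : exists M, forall v k, (v < b.+1)%N -> (M <= k)%N ->
    v != 1%N -> (same_comp v (hist f k) <= same_comp 1 (hist f k))%N = beta v.
  apply: uniform_threshold => v _; have [->|v1] := eqVneq v 1%N; first by exists 0%N.
  by have [M hM] := hbeta v v1; exists M => k Mk _; exact: hM.
pose n := maxn (maxn M b) m0.
have cst k : (n <= k)%N -> rank (edge (hist f k)) k.+1 1 =
    (count (fun u => (u != 1%N) && beta u) (vertices b)).+1.
  move=> nk; have Mk := leq_trans (leq_trans (leq_maxl M b) (leq_maxl _ m0)) nk.
  have bk := leq_trans (leq_trans (leq_maxr M b) (leq_maxl _ m0)) nk.
  have mk := leq_trans (leq_maxr (maxn M b) m0) nk.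
  have := rank_root (valid_hist k hf); rewrite size_hist => ->; congr _.+1.
  rewrite (count_vertices (leqW bk)) => [|u /andP[bu uk]]; last first.
    by rewrite negb_and far ?orbT // ltnW.
  apply: eq_in_count => u; rewrite mem_vertices => /andP[_ ub].
  by case: (eqVneq u 1%N) => //= u1; rewrite hM.
by exists n => k nk; rewrite !cst.
Qed.

(** * Measurability and the limiting random variables *)

Lemma measurable_of_preimages d (T : measurableType d) (f : T -> nat) :
  (forall n, measurable (f @^-1` [set n])) -> measurable_fun setT f.
Proof.
move=> h _ B _; rewrite setTI.
rewrite (_ : f @^-1` B = \bigcup_(n in B) f @^-1` [set n]).
  by apply: bigcup_measurable => n _.
by apply/seteqP; split => [w /= hw|w [n Bn /= ->]//]; exists (f w).
Qed.

(** Zero is free to stand for infinity, as the finite times and ranks to be encoded are positive. *)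
Definition code (R : realType) (n : nat) : \bar R :=
  if n is 0%N then +oo%E else (n%:R)%:E.

Lemma code_rv d (Omega : measurableType d) (R : realType)
    (P : probability Omega R) (f : Omega -> nat) :
  (forall n, measurable (f @^-1` [set n])) ->
  exists2 X : {RV P >-> \bar R}, forall w, X w = code R (f w) &
    extended_integer_valued X.
Proof.
move=> hf; have mX : measurable_fun setT (fun w => code R (f w)).
  apply: (@measurableT_comp _ _ _ _ _ _ (code R)) => //.
  exact: measurable_of_preimages.
exists (mfun_Sub (mem_set mX)) => // w.
rewrite mfun_valP /code; case: (f w) => [|n]; [by right|left].
by exists n.+1%:Z.
Qed.

Theorem theorem27 (d : measure_display) (Omega : measurableType d)
  (R : realType) (P : probability Omega R) (T : nat -> Omega -> rel nat) :
  is_URRT P T ->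
  exists N K : {RV P >-> \bar R},
  [/\ extended_integer_valued N, extended_integer_valued K,
      P [set w | (N w < +oo)%E] = 1%E, P [set w | (K w < +oo)%E] = 1%E &
      forall n w, (0 < n)%N -> (N w <= (n%:R)%:E)%E ->
        ((rank (T n w) n 1)%:R)%:E = K w].
Proof.
move=> [U [Uv Uunif Uind T1 TS]].
have TE k w : T k.+1 w = edge (history U k w).
  elim: k => [|k IH]; first by apply/funext => x; apply/funext => y; rewrite T1.
  apply/funext => x; apply/funext => y; rewrite TS // IH /history /=.
  by rewrite /edge -/edge size_hist.
pose rk k w := rank (edge (history U k w)) k.+1 1.
have mrk k (p : pred nat) : measurable [set w | p (rk k w)].
  exact: (measurable_history U k (fun l => p (rank (edge l) k.+1 1))).
pose cst n : set Omega := [set w | forall k, (n <= k)%N -> rk k w = rk n w].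
have mcst n : measurable (cst n).
  (* Equality of two ranks is split by their common value, which gives a countable union of
     measurable sets. *)
  rewrite (_ : cst n = \bigcap_(k in [set k | (n <= k)%N])
     \bigcup_a ([set w | rk k w == a] `&` [set w | rk n w == a])).
    apply: bigcap_measurable => [|k _]; first by exists n => /=.
    apply: bigcupT_measurable => a.
    by apply: measurableI; exact: (mrk _ (fun x => x == a)).
  apply/seteqP; split => [w hw k /= nk|w hw k nk].
    by exists (rk n w) => //; split => /=; rewrite ?hw.
  by have [a _ [/= /eqP -> /eqP ->]] := hw k nk.
have good : {ae P, forall w, exists n, cst n w}.
  have h1 : {ae P, forall w, forall v, v != 1%N -> exists (c : R) m, 0 < c /\
      forall k, (m <= k)%N -> c < `|ngap R v (history U k w)|}.
    apply/ae_foralln => v; have [->|v1] := eqVneq v 1%N; first by apply: aeW.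
    by apply: filterS (ae_gap Uv Uunif Uind v1) => w hw _.
  have h2 : {ae P, forall w, forall j : nat, exists m, forall v k,
      (m <= v)%N -> (v <= k.+1)%N -> nbelow R v (history U k w) < j.+1%:R^-1}.
    by apply/ae_foralln => j; apply: (ae_below Uv Uunif Uind); rewrite invr_gt0.
  apply: filterS2 h1 h2 => w hw1 hw2.
  exact: (rank_eventually_constant (fun n => Uv n w) hw1 hw2).
(* The shift by one turns the history length [n] into the index [n.+1] of the tree and frees 0 for
   the case without stabilization. Taking the least [n] makes the preimages Boolean combinations of
   the sets [cst]. *)
have /choice[nval hnval] : forall w, exists m : nat,
    if m is n.+1 then cst n w /\ forall j, cst j w -> (n <= j)%N
    else forall j, ~ cst j w.
  move=> w; have [[j hj]|nh] := pselect (exists n, cst n w); last first.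
    by exists 0%N => j hj; apply: nh; exists j.
  have ex : exists n, `[< cst n w >] by exists j; apply/asboolP.
  case: (ex_minnP ex) => n /asboolP hn nmin; exists n.+1; split => // i hi.
  by apply: nmin; apply/asboolP.
have mnval n : measurable (nval @^-1` [set n]).
  case: n => [|n].
    rewrite (_ : _ @^-1` _ = ~` \bigcup_j cst j).
      by apply: measurableC; exact: bigcupT_measurable.
    apply/seteqP; split => [w /= h|w /= h].
      by have := hnval w; rewrite h => nc -[j _]; exact: nc.
    by have := hnval w; case: (nval w) => // n [hn _]; case: h; exists n.
  rewrite (_ : _ @^-1` _ = cst n `\` \bigcup_(j in [set j | (j < n)%N]) cst j).
    by apply: measurableD => //; exact: bigcup_measurable.
  apply/seteqP; split => [w /= h|w [hn nh]].
    have := hnval w; rewrite h => -[cn nmin]; split => // -[j /= jn /nmin].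
    by rewrite leqNgt jn.
  have := hnval w; rewrite /=; case: (nval w) => [/(_ n)//|m [hm mmin]].
  congr _.+1; apply/eqP; rewrite eqn_leq (mmin _ hn) leqNgt /=.
  by apply/negP => mn; apply: nh; exists m.
pose kval w := if nval w is n.+1 then rk n w else 0%N.
have mkval a : measurable (kval @^-1` [set a]).
  rewrite (_ : _ @^-1` _ = \bigcup_m ((nval @^-1` [set m]) `&`
      [set w | (if m is n.+1 then rk n w else 0%N) == a])).
    apply: bigcupT_measurable => m; apply: measurableI => //.
    case: m => [|n]; last exact: (mrk n (fun x => x == a)).
    case: (0%N == a).
      by rewrite (_ : [set _ | _] = setT) //; apply/seteqP; split.
    by rewrite (_ : [set _ | _] = set0) //; apply/seteqP; split.
  apply/seteqP; split => [w /= h|w [m _ [/= h1 /eqP h2]]].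
    by exists (nval w) => //; split => //=; apply/eqP.
  by rewrite /kval h1.
(* Ranks are successors, so K is infinite exactly where N is. *)
have kval0 w : (kval w == 0%N) = (nval w == 0%N).
  by rewrite /kval; case: (nval w).
have code_fin n : (code R n < +oo)%E = (n != 0%N).
  by case: n => [|n]; rewrite /code ?ltxx // ltry.
have prob1 (f : Omega -> nat) : (forall w, (f w == 0%N) = (nval w == 0%N)) ->
    P [set w | (code R (f w) < +oo)%E] = 1%E.
  move=> hf; rewrite (_ : [set w | _] = ~` (nval @^-1` [set 0%N])).
    rewrite probability_setC //; apply/eqP.
    have : P.-negligible (nval @^-1` [set 0%N]).
      apply: negligibleS good => w /= h0 [j hj].
      by have := hnval w; rewrite h0 => /(_ j).
    by move=> /negligibleP ->; rewrite ?sube0.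
  apply/seteqP; split => w /=; rewrite code_fin hf.
    by move=> /eqP.
  by move=> /eqP.
have [N NE Nint] := code_rv P mnval; have [K KE Kint] := code_rv P mkval.
exists N, K; split => //.
- by under eq_set do rewrite NE; exact: prob1.
- by under eq_set do rewrite KE; exact: prob1.
(* The tree of index [k.+1] has history length [k]. Where N is infinite, the assumed bound on N
   fails. *)
case=> [//|k] w _; rewrite NE KE TE -/(rk k w) /code /kval.
have := hnval w; case: (nval w) => [_|n [hn _]].
  by rewrite leye_eq.
rewrite lee_fin ler_nat => nk.
by rewrite (hn k nk) /rk /rank.
Qed.
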